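(* Let $0<\alpha_0<r$ be fixed, let $0<\alpha\le\alpha_0$ and let $\hat s^{(l)}_{\hat m}$ be the model selection estimator associated with the model collections $\mathcal{M}^{(l)}_n$. Assume that $(\lambda_n)_n$ is a non-decreasing sequence of positive numbers with $\lim_{n\to+\infty}n^{-1}\lambda_n=0$, and that there exist $n_0\in\mathbb{N}^*$, $0<\delta\le\frac12$, $0<p<1$ and $\kappa>1$ such that $\lambda_{2n}\le2(1-\delta)\lambda_n$ for every $n\ge n_0$, $\lambda_{n_0}\ge\Upsilon(\delta,p,\alpha_0)$, and for every $n$ $$\sum_{m\in\mathcal{M}^{(l)}_n}e^{-\frac{(\sqrt{\kappa^{-1}\lambda_n}-1)^2D_m}{2}}\le\sqrt{1-p}.$$ Then $$MS\left(\hat s^{(l)}_{\hat m},\rho_\alpha\right):=:\mathcal{B}^{\frac{\alpha}{1+2\alpha}}_{2,\infty}\cap\mathcal{W}_{\frac{2}{1+2\alpha}}.$$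
   Context: Gaussian white noise model on $[0,1]$: $s\in\mathbb{L}_2([0,1])$ is unknown, $\|\cdot\|$ is the $\mathbb{L}_2([0,1])$ norm, and for $n\in\mathbb{N}^*=\{1,2,\dots\}$ one observes, for all $u\in\mathbb{L}_2([0,1])$, $Y_n(u)=\int_0^1u(t)s(t)\,dt+\frac{1}{\sqrt n}W_u$, where $(W_u)$ is a centered Gaussian process with $\mathbb{E}[W_uW_{u'}]=\int_0^1u(t)u'(t)\,dt$. Wavelets: $\phi,\psi$ are a compactly supported scaling function and wavelet whose dilates/translates $\phi_{jk}(x)=2^{j/2}\phi(2^jx-k)$, $\psi_{jk}(x)=2^{j/2}\psi(2^jx-k)$, once periodized, give an orthonormal basis $\Psi=\{\phi_{00},\psi_{jk}:j\ge0,\ 0\le k\le2^j-1\}$ of $\mathbb{L}_2([0,1])$; the associated multiresolution analysis is $r$-regular (in the sense of Meyer) with $r\ge1$. Write $s=\alpha_{00}\phi_{00}+\sum_{j\ge0}\sum_{k=0}^{2^j-1}\beta_{jk}\psi_{jk}$. Models: the maximal resolution level $j_0(n)$, non-decreasing in $n$, is given by $2^{j_0(n)}\le n\lambda_n^{-1}<2^{j_0(n)+1}$; $\mathcal{I}^{j_0}=\bigcup_{0\le j<j_0(n)}\{(j,k):0\le k\le2^j-1\}$; $\mathcal{M}^{(l)}_n=\{m=\mathrm{span}\{\phi_{00},\psi_{jk}:(j,k)\in\mathcal{I}_m\}:\ \mathcal{I}_m\subset\mathcal{I}^{j_0}\}$ (all subsets). $D_m$ is the dimension of $m$. For a model $m$,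 $\hat s_m$ minimizes $\gamma_n(u)=-2Y_n(u)+\|u\|^2$ over $u\in m$; the model selection estimator associated with collections $\mathcal{M}_n$ is $\hat s_{\hat m}$ with $\hat m=\arg\min_{m\in\mathcal{M}_n}\{\gamma_n(\hat s_m)+\frac{\lambda_n}{n}D_m\}$. Notation: $\rho_\alpha=(\rho_{n,\alpha})_n$, $\rho_{n,\alpha}=\left(\frac{\lambda_n}{n}\right)^{\frac{\alpha}{1+2\alpha}}$; $g(\delta,\alpha_0)=(1-\delta)^{\frac{2\alpha_0}{2\alpha_0+1}}-1+\delta$; $\Upsilon(\delta,p,\alpha_0)=\frac{8}{p\,g(\delta,\alpha_0)}\left(\frac{16}{g(\delta,\alpha_0)}+1\right)$. Function spaces: $\mathcal{B}^{\frac{\alpha}{1+2\alpha}}_{2,\infty}=\{s\in\mathbb{L}_2([0,1]):\sup_{J\in\mathbb{N}}2^{\frac{2J\alpha}{1+2\alpha}}\sum_{j\ge J}\sum_{k=0}^{2^j-1}\beta_{jk}^2<\infty\}$. For $0<q<2$, $\mathcal{W}_q=\{s\in\mathbb{L}_2([0,1]):\sup_{n\in\mathbb{N}^*}n^{1/q}|\beta|_{(n)}<\infty\}$, where $|\beta|_{(n)}=\inf\{u:\mathrm{card}\{(j,k):j\ge0,0\le k\le2^j-1,|\beta_{jk}|>u\}<n\}$ is the non-increasing rearrangement of the wavelet coefficients. Balls are given by bounding these suprema by the radius; the ball of an intersection is the intersection of the balls. Maxisets: for an estimator $\hat s$, $MS(\hat s,\rho_\alpha)=\{s\in\mathbb{L}_2([0,1]):\sup_n\{\rho_{n,\alpha}^{-2}\mathbb{E}[\|\hat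 s-s\|^2]\}<\infty\}$, and its ball $MS(\hat s,\rho_\alpha)(R)$ is the set of $s$ for which this supremum is $\le R^2$. $MS(\hat s,\rho_\alpha):=:\mathcal{F}$ means: for every $R>0$ there is $R'>0$ with $MS(\hat s,\rho_\alpha)(R)\subset\mathcal{F}(R')$, and for every $R'>0$ there is $R>0$ with $\mathcal{F}(R')\subset MS(\hat s,\rho_\alpha)(R)$. *)

(* Defs.v *)
(* MathComp-Analysis.  Elements of L2(D) are represented by functions R -> R,
   of which only the restriction to D matters; two of them are the same element
   when the L2(D) norm of their difference is 0. *)
From HB Require Import structures.
From mathcomp Require Import all_boot all_order all_algebra.
From mathcomp Require Import all_classical all_reals all_analysis.

Set Implicit Arguments.
Unset Strict Implicit.
Unset Printing Implicit Defensive.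
Import Order.TTheory GRing.Theory Num.Theory.
Import numFieldNormedType.Exports.

Local Open Scope classical_set_scope.
Local Open Scope ring_scope.
Local Open Scope card_scope.

Section L2_spaces.
Context {R : realType}.
Implicit Types (D : set R) (f g u : R -> R) (V E : set (R -> R)).

Definition L2 D : set (R -> R) :=
  [set f : R -> R | measurable_fun D f /\
     (@lebesgue_measure R).-integrable D (fun x => (f x ^+ 2)%:E)].

Definition ip D f g : R := \int[@lebesgue_measure R]_(x in D) (f x * g x).

Definition norm2 D f : R := Num.sqrt (ip D f f).

Definition lin_span E : set (R -> R) :=
  [set u | exists (N : nat) (e : 'I_N -> R -> R) (c : 'I_N -> R),
     (forall k, E (e k)) /\ u = (fun x => \sum_(k < N) c k * e k x)].

Definition dense_in D V E : Prop :=
  forall f, V f -> forall eps : R, 0 < eps ->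
    exists2 u, E u & norm2 D (f \- u) < eps.

Definition closed_subspace D V : Prop :=
  [/\ V `<=` L2 D,
      V (fun=> 0),
      forall (a : R) f g, V f -> V g -> V (fun x => a * f x + g x) &
      forall f, L2 D f ->
        (forall eps : R, 0 < eps -> exists2 g, V g & norm2 D (f \- g) < eps) ->
        V f].

Definition orthonormal_basis D V (I : choiceType) (A : set I)
    (e : I -> R -> R) : Prop :=
  [/\ forall i, A i -> V (e i),
      forall i j, A i -> A j -> ip D (e i) (e j) = (i == j)%:R &
      dense_in D V (lin_span (e @` A))].

(* basis of V as a subspace of L2(D), i.e. up to equality in L2(D) *)
Definition finite_basis D V (N : nat) (e : 'I_N -> R -> R) : Prop :=
  [/\ forall k, V (e k),
      forall c : 'I_N -> R,
        norm2 D (fun x => \sum_(k < N) c k * e k x) = 0 -> forall k, c k = 0 &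
      forall v, V v -> exists c : 'I_N -> R,
        norm2 D (v \- (fun x => \sum_(k < N) c k * e k x)) = 0].

Definition dimension D V : nat :=
  xget 0%N [set N | exists e : 'I_N -> R -> R, finite_basis D V e].

End L2_spaces.

Section wavelets.
Context {R : realType}.
Implicit Types (f g h phi psi theta s : R -> R) (V : int -> set (R -> R)).

Definition compactly_supported f : Prop :=
  exists2 K : set R, compact K & forall x, ~ K x -> f x = 0.

Definition translate f (k : int) : R -> R := fun x => f (x - k%:~R).

Definition riesz_basis (V0 : set (R -> R)) g : Prop :=
  [/\ V0 g,
      dense_in setT V0 (lin_span (range (translate g))) &
      exists A B : R, [/\ 0 < A, 0 < B & forall (l : seq int) (c : int -> R),
        uniq l ->
        A * (\sum_(k <- l) c k ^+ 2)
          <= norm2 setT (fun x => \sum_(k <- l) c k * translate g k x) ^+ 2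
          <= B * (\sum_(k <- l) c k ^+ 2)]].

Definition test_function theta : Prop :=
  compactly_supported theta /\
  forall (n : nat) (x : R), derivable (derive1n n theta) x 1.

(* h is the a-th derivative of g in the sense of distributions; the derivatives
   in Meyer's regularity condition are taken in this sense, so that for instance
   continuous piecewise affine splines are 1-regular. *)
Definition weak_derivative (a : nat) g h : Prop :=
  measurable_fun setT h /\
  forall theta, test_function theta ->
    \int[@lebesgue_measure R]_x (g x * derive1n a theta x)
    = (-1) ^+ a * \int[@lebesgue_measure R]_x (h x * theta x).

Definition regular_riesz_generator (r : nat) g : Prop :=
  forall a : nat, (a <= r)%N -> exists2 h, weak_derivative a g h &
    forall m : nat, exists C : R, forall x, `|h x| <= C * (1 + `|x|) ^- m.

Definition multiresolution V : Prop :=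
  [/\ forall j, closed_subspace setT (V j),
      forall j, V j `<=` V (j + 1),
      forall f, (forall j, V j f) -> norm2 setT f = 0,
      dense_in setT (L2 setT) (\bigcup_j V j) &
      (forall j f, V j f <-> V (j + 1) (fun x => f (2 * x))) /\
      (forall f k, V 0 f <-> V 0 (translate f k))].

Definition regular_multiresolution (r : nat) V : Prop :=
  multiresolution V /\
  exists2 g, riesz_basis (V 0) g & regular_riesz_generator r g.

Definition scaling_function V phi : Prop :=
  orthonormal_basis setT (V 0) setT (translate phi).

Definition wavelet V psi : Prop :=
  orthonormal_basis setT
    [set f | V 1 f /\ forall g, V 0 g -> ip setT f g = 0] setT (translate psi).

Definition dilate f (j k : nat) : R -> R :=
  fun x => 2 `^ (j%:R / 2) * f (2 ^+ j * x - k%:R).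

(* For compactly supported f the sum over the integers is finite. *)
Definition periodize f : R -> R :=
  fun x => \sum_(l \in [set: int]) f (x + l%:~R).

(* phi_00 is indexed by None and psi_jk by Some (j, k) *)
Definition wavelet_index : set (option (nat * nat)) :=
  [set i | if i is Some (j, k) then (k < 2 ^ j)%N else True].

Definition wavelet_family phi psi (i : option (nat * nat)) : R -> R :=
  if i is Some (j, k) then periodize (dilate psi j k)
  else periodize (dilate phi 0 0).

Definition wavelet_setting (r : nat) phi psi : Prop :=
  [/\ compactly_supported phi,
      compactly_supported psi,
      exists V, [/\ regular_multiresolution r V, scaling_function V phi
                  & wavelet V psi] &
      orthonormal_basis `[0, 1] (L2 `[0, 1]) wavelet_index
        (wavelet_family phi psi)].

Definition beta psi s (j k : nat) : R :=
  ip `[0, 1] s (periodize (dilate psi j k)).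

(* non-increasing rearrangement |beta|_(n) *)
Definition rearrangement psi s (n : nat) : R :=
  inf [set u : R | exists2 N : nat, (N < n)%N &
    [set jk : nat * nat | (jk.2 < 2 ^ jk.1)%N /\ u < `|beta psi s jk.1 jk.2|]
      #= `I_N].

(* ball of radius rad of B^a_{2,oo} *)
Definition besov_ball psi (a rad : R) : set (R -> R) :=
  [set s | L2 `[0, 1] s /\
    (ereal_sup (range (fun J : nat =>
       (2 `^ (2 * J%:R * a))%:E *
       \sum_(J <= j <oo) (\sum_(k < 2 ^ j) beta psi s j k ^+ 2)%:E))
     <= rad%:E)%E].

(* ball of radius rad of W_q *)
Definition weak_ball psi (q rad : R) : set (R -> R) :=
  [set s | L2 `[0, 1] s /\
    (ereal_sup [set (n%:R `^ q^-1 * rearrangement psi s n)%:E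
                | n in [set n : nat | (0 < n)%N]]
     <= rad%:E)%E].

Definition index_set (J : int) : set (nat * nat) :=
  [set jk | (jk.1%:Z < J)%R /\ (jk.2 < 2 ^ jk.1)%N].

Definition model phi psi (I : set (nat * nat)) : set (R -> R) :=
  lin_span (wavelet_family phi psi @` (None |` (Some @` I))).

Definition models phi psi (J : int) : set (set (R -> R)) :=
  [set m | exists2 I, I `<=` index_set J & m = model phi psi I].

End wavelets.

Section white_noise.
Context {R : realType} {d : measure_display} {T : measurableType d}.
Variable P : probability T R.
Implicit Types (W : (R -> R) -> {RV P >-> R}) (s u v : R -> R).

(* a standard deviation sigma = 0 is the point mass at mu *)
Definition gaussian (X : T -> R) : Prop :=
  exists mu sigma : R, 0 <= sigma /\
    forall A : set R, measurable A ->
      P (X @^-1` A) = if sigma == 0 then \d_mu A else normal_prob mu sigma A.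

Definition gaussian_process W : Prop :=
  forall (N : nat) (u : 'I_N -> R -> R) (c : 'I_N -> R),
    (forall k, L2 `[0, 1] (u k)) ->
    gaussian (fun w => \sum_(k < N) c k * W (u k) w).

Definition white_noise W : Prop :=
  [/\ gaussian_process W,
      forall u, L2 `[0, 1] u -> ('E_P[W u] = 0)%E &
      forall u v, L2 `[0, 1] u -> L2 `[0, 1] v ->
        ('E_P[fun w => (W u w * W v w)%R] = (ip `[0, 1] u v)%:E)%E].

(* The covariance makes u |-> W_u linear up to an event of probability 0 that
   depends on the linear combination.  Minimizing a contrast over the
   uncountably many elements of a model is meaningful for a version of W whose
   paths are linear there. *)
Definition linear_paths W (V : set (R -> R)) : Prop :=
  forall (w : T) (a : R) u v, V u -> V v ->
    W (fun x => a * u x + v x) w = a * W u w + W v w.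

(* the path u |-> Y_n(u) observed at the outcome w when the signal is s *)
Definition observation W (n : nat) s (w : T) : (R -> R) -> R :=
  fun u => ip `[0, 1] u s + (Num.sqrt n%:R)^-1 * W u w.

End white_noise.

Section model_selection.
Context {R : realType}.
Implicit Types (y : (R -> R) -> R) (m : set (R -> R)).

Definition contrast y (u : R -> R) : R :=
  - 2 * y u + norm2 `[0, 1] u ^+ 2.

Definition penalized_contrast (pen : R)
    (shat : set (R -> R) -> ((R -> R) -> R) -> R -> R) y m : R :=
  contrast y (shat m y) + pen * (dimension `[0, 1] m)%:R.

(* shat n m y and mhat n y are computed from the observed path y *)
Definition model_selection {d : measure_display} {T : measurableType d}
    (P : probability T R) (W : (R -> R) -> {RV P >-> R})
    (M : nat -> set (set (R -> R))) (lambda : nat -> R)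
    (shat : nat -> set (R -> R) -> ((R -> R) -> R) -> R -> R)
    (mhat : nat -> ((R -> R) -> R) -> set (R -> R)) : Prop :=
  forall (n : nat) (s : R -> R), (0 < n)%N -> L2 `[0, 1] s ->
  [/\ forall w m, M n m ->
        let y := observation W n s w in
        m (shat n m y) /\
        forall u, m u -> contrast y (shat n m y) <= contrast y u,
      forall w,
        let y := observation W n s w in
        let crit := penalized_contrast (lambda n / n%:R) (shat n) y in
        M n (mhat n y) /\ forall m, M n m -> crit (mhat n y) <= crit m &
      forall m, M n m -> measurable [set w | mhat n (observation W n s w) = m]].

Definition selected_estimator
    (shat : nat -> set (R -> R) -> ((R -> R) -> R) -> R -> R)
    (mhat : nat -> ((R -> R) -> R) -> set (R -> R))
    (n : nat) y : R -> R :=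
  shat n (mhat n y) y.

Definition rate (lambda : nat -> R) (alpha : R) (n : nat) : R :=
  (lambda n / n%:R) `^ (alpha / (1 + 2 * alpha)).

Definition maxiset_ball {d : measure_display} {T : measurableType d}
    (P : probability T R) (W : (R -> R) -> {RV P >-> R})
    (est : nat -> ((R -> R) -> R) -> R -> R) (rho : nat -> R) (rad : R) :
    set (R -> R) :=
  [set s | L2 `[0, 1] s /\
    (ereal_sup [set (rho n ^- 2)%:E *
        'E_P[fun w => (norm2 `[0, 1] (est n (observation W n s w) \- s) ^+ 2)%R]
      | n in [set n : nat | (0 < n)%N]]
     <= (rad ^+ 2)%:E)%E].

(* the relation :=: between spaces given by their families of balls *)
Definition ball_equiv (F G : R -> set (R -> R)) : Prop :=
  (forall rad : R, 0 < rad -> exists2 rad' : R, 0 < rad' & F rad `<=` G rad') /\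
  (forall rad' : R, 0 < rad' -> exists2 rad : R, 0 < rad & G rad' `<=` F rad).

Definition g_const (delta alpha0 : R) : R :=
  (1 - delta) `^ (2 * alpha0 / (2 * alpha0 + 1)) - 1 + delta.

Definition Upsilon (delta p alpha0 : R) : R :=
  8 / (p * g_const delta alpha0) * (16 / g_const delta alpha0 + 1).

End model_selection.

(* Main.v *)
Require Import Defs.
From HB Require Import structures.
From mathcomp Require Import all_boot all_order all_algebra.
From mathcomp Require Import all_classical all_reals all_analysis.
From mathcomp Require Import measurable_realfun.
From mathcomp Require Import ring lra.

(** The collection holds every subset of the details of level below [j0 n], and
    both the contrast and the penalty are additive over the coordinates. Hence
    the selected estimator is hard thresholding: with the threshold
    [t = sqrt (lambda n / n)], an empirical coefficient is kept above [t] and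
    set to zero below ([penalized_minimizer]). Its risk is a sum of
    one-dimensional risks plus the energy of the levels from [j0 n] on
    ([risk_eq]), so only the marginal laws of the noise matter, and they are
    N(0, 1) ([gaussian_std_normal]). Write [a = alpha / (1 + 2 alpha)] and
    [q = 2 / (1 + 2 alpha)]; then [2 - q = 4 a], and the squared rate is
    [t ^ (4 a) = t ^ (2 - q)].

    From the maxiset to the balls. A coefficient [b] with [|b| <= t] is set to
    zero with a probability bounded below, and then costs [b ^ 2]. So the risk
    bounds, up to a constant, both the energy of the levels from [j0 n] on and
    the energy [S(t)] of the coefficients of modulus at most [t] ([risk_ge]).
    The first bound is the Besov condition, provided that [j0 n] takes every
    value [J >= 0]: it tends to infinity by steps of at most 1 ([j0_hits]), and
    it starts at or below 0 because otherwise the condition on the weighted sum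
    over the models would fail for some [n] ([j0_1_le0]). This last point is
    essential: were level 0 estimated from [n = 1] on, its coefficient, however
    large, would always be kept and would cost only the noise. The second bound
    reads [S(u) <= K u ^ (2 - q)] for all [u > 0], since consecutive thresholds
    are within a factor [sqrt 2]; summing dyadic shells, this gives the count
    [#{|b| > u} <= A u ^ (- q)], which is the weak ball ([exceedances_le],
    [exceedances_weak_ball]).

    From the balls to the maxiset. A coefficient with [|b| <= eps t] costs
    [b ^ 2], plus the noise on the event that the noise alone crosses
    [(1 - eps) t]; any other costs at most a multiple of [t ^ 2] ([risk_le]).
    The weak ball bounds the number of the latter and, by dyadic shells again,
    the total energy of the former ([small_energy_le]); the Besov ball bounds
    the levels from [j0 n] on. There remains the number [N] of details times a
    Gaussian tail. The weighted sum over the subsets is [x (1 + x) ^ N] with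
    [x = exp (- (sqrt (lambda / kappa) - 1) ^ 2 / 2)]; as it is at most 1, the
    product [N exp (- (1 + eta) lambda / (2 kappa))] is bounded for every
    [eta > 0] ([powerset_sum_bound]), and [kappa > 1] leaves room for such an
    [eta], for [eps] and for the loss in the Gaussian tail. *)

Set Implicit Arguments.
Unset Strict Implicit.
Unset Printing Implicit Defensive.
Import Order.TTheory GRing.Theory Num.Theory.
Import numFieldNormedType.Exports.

Local Open Scope classical_set_scope.
Local Open Scope ring_scope.

(** * Standard normal variables *)

Section gauss.
Context {R : realType}.
Local Notation leb := (@lebesgue_measure R).

(** The Radon-Nikodym derivative of a normal law is its density almost
    everywhere, which turns expectations under the law into Lebesgue integrals. *)
Lemma integral_normal_prob (m s : R) (g : R -> \bar R) :
  measurable_fun setT g -> (forall x, (0 <= g x)%E) ->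
  (\int[normal_prob m s : probability (measurableTypeR R) R]_x g x =
   \int[leb]_x (g x * (normal_pdf m s x)%:E))%E.
Proof.
move=> mg g0; have dom := @normal_prob_dominates R m s.
rewrite -(Radon_Nikodym_SigmaFinite.change_of_variables dom)//.
have mf := measurable_int _ (Radon_Nikodym_SigmaFinite.f_integrable dom).
have mp : measurable_fun [set: R] (fun x : R => (normal_pdf m s x)%:E).
  apply/measurable_EFinP; exact: measurable_normal_pdf.
apply: ae_eq_integral => //; try exact: emeasurable_funM.
apply: ae_eqe_mul2l => /=; apply: integral_ae_eq => //.
  exact: Radon_Nikodym_SigmaFinite.f_integrable.
move=> E _ mE.
by rewrite -(Radon_Nikodym_SigmaFinite.f_integral dom).
Qed.

(** Completing the square: an exponential tilt only moves the mean. It yields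
    the Laplace transform without any integration. *)
Lemma normal_pdf_tilt (m s t x : R) : s != 0 ->
  expR (t * x) * normal_pdf m s x =
  expR (m * t + s ^+ 2 * t ^+ 2 / 2) * normal_pdf (m + s ^+ 2 * t) s x.
Proof.
move=> s0; rewrite !normal_pdfE// /normal_fun !mulrA.
rewrite ![expR _ * normal_peak _]mulrC -!mulrA -!expRD; congr (_ * expR _).
by rewrite -mulr_natr; field.
Qed.

(** A quadratic tilt only changes the variance. *)
Lemma normal_pdf_sqr_tilt (s t x : R) : s != 0 -> t * s ^+ 2 < 1 ->
  expR (t * x ^+ 2 / 2) * normal_pdf 0 s x =
  (Num.sqrt (1 - t * s ^+ 2))^-1
  * normal_pdf 0 (s / Num.sqrt (1 - t * s ^+ 2)) x.
Proof.
move=> s0 ts; have d0 : 0 < 1 - t * s ^+ 2 by rewrite subr_gt0.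
have q0 : Num.sqrt (1 - t * s ^+ 2) != 0 by rewrite gt_eqF// sqrtr_gt0.
have s'0 : s / Num.sqrt (1 - t * s ^+ 2) != 0 by rewrite mulf_neq0// invr_eq0.
rewrite !normal_pdfE// /normal_fun mulrCA -expRD [RHS]mulrA.
have e : (s / Num.sqrt (1 - t * s ^+ 2)) ^+ 2 = s ^+ 2 / (1 - t * s ^+ 2).
  by rewrite expr_div_n sqr_sqrtr// ltW.
congr (_ * expR _); last first.
  rewrite e !mulr2n; field.
  by rewrite (gt_eqF d0) -mulr2n mulrn_eq0 expf_eq0 (negbTE s0).
rewrite /normal_peak e -invfM -sqrtrM ?(ltW d0)//; congr (Num.sqrt _)^-1.
by rewrite !mulr2n; field; rewrite gt_eqF.
Qed.

End gauss.

Section gauss_rv.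
Context {R : realType} {d : measure_display} {T : measurableType d}.
Variable P : probability T R.
Implicit Types X : {RV P >-> R}.

Lemma ge0_integral_law X (nu : probability (measurableTypeR R) R)
    (g : R -> \bar R) :
  (forall A : set R, measurable A -> P (X @^-1` A) = nu A) ->
  measurable_fun [set: R] g -> (forall x, (0 <= g x)%E) ->
  (\int[P]_w g (X w) = \int[nu]_x g x)%E.
Proof.
move=> lawX mg g0.
have mX : measurable_fun setT (X : T -> measurableTypeR R).
  by move=> mT B mB; exact: (measurable_funP X mT B mB).
have := @ge0_integral_pushforward _ _ _ _ R _ mX P setT g measurableT mg
  (fun y _ => g0 y).
rewrite preimage_setT => <-.
by apply: eq_measure_integral => A mA _; exact: lawX.
Qed.

(** Jensen's inequality for the exponential, in the weak form [1 + y <= exp y]. *)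
Lemma integral_expR_ge1D (Y : T -> R) : P.-integrable setT (EFin \o Y) ->
  (1 + \int[P]_w (Y w)%:E <= \int[P]_w (expR (Y w))%:E)%E.
Proof.
move=> iY; have mY : measurable_fun setT Y.
  by apply/measurable_EFinP; exact: (measurable_int P).
have i1 : P.-integrable setT (fun=> 1%:E : \bar R).
  exact: finite_measure_integrable_cst.
have [->|] := eqVneq (\int[P]_w (expR (Y w))%:E)%E +oo%E; first exact: leey.
rewrite -ltey => ley.
rewrite [X in (X + _)%E](_ : _ = \int[P]_w 1%:E)%E; last first.
  by rewrite integral_cst// mul1e; exact/esym/probability_setT.
rewrite -integralD//; apply: le_integral => //.
- exact: integrableD.
- apply/integrableP; split.
    by apply/measurable_EFinP; exact: measurableT_comp.
  by under eq_integral do rewrite gee0_abs ?lee_fin ?expR_ge0//.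
- by move=> w _; rewrite -EFinD lee_fin; exact: expR_ge1Dx.
Qed.

Section law.
Variables (X : {RV P >-> R}) (m s : R).
Hypothesis s0 : s != 0.
Hypothesis lawX : forall A : set R, measurable A -> P (X @^-1` A) = normal_prob m s A.

Let mgf t : (\int[P]_w (expR (t * X w))%:E =
   (expR (m * t + s ^+ 2 * t ^+ 2 / 2))%:E)%E.
Proof.
have mg : measurable_fun [set: R] (fun x : R => (expR (t * x))%:E).
  by apply/measurable_EFinP; apply: measurableT_comp => //; exact: measurable_funM.
have g0 x : (0 <= (expR (t * x))%:E)%E by rewrite lee_fin expR_ge0.
rewrite (ge0_integral_law lawX mg g0) integral_normal_prob//.
under eq_integral do rewrite -EFinM normal_pdf_tilt// EFinM.
rewrite ge0_integralZl ?integral_normal_pdf ?mule1//.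
- by apply/measurable_EFinP; exact: measurable_normal_pdf.
- by move=> x _; rewrite lee_fin normal_pdf_ge0.
Qed.

Lemma normal_sqr_mgf t : m = 0 -> t * s ^+ 2 < 1 ->
  (\int[P]_w (expR (t * X w ^+ 2 / 2))%:E =
   (Num.sqrt (1 - t * s ^+ 2))^-1%:E)%E.
Proof.
move=> m0 ts.
have mg : measurable_fun [set: R] (fun x : R => (expR (t * x ^+ 2 / 2))%:E).
  apply/measurable_EFinP; apply: measurableT_comp => //.
  by apply: measurable_funM => //; exact: measurable_funM.
have g0 x : (0 <= (expR (t * x ^+ 2 / 2))%:E)%E by rewrite lee_fin expR_ge0.
rewrite (ge0_integral_law lawX mg g0) integral_normal_prob//.
rewrite m0; under eq_integral do rewrite -EFinM normal_pdf_sqr_tilt// EFinM.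
rewrite ge0_integralZl ?integral_normal_pdf ?mule1//.
- by apply/measurable_EFinP; exact: measurable_normal_pdf.
- by move=> x _; rewrite lee_fin normal_pdf_ge0.
Qed.



(** Both parameters are read off exponential moments: [1 + y <= exp y] puts
    [t |-> E exp (t Y)] above the line [1 + t E Y], which it meets at [t = 0], so
    this line is its tangent there. Take [Y = X], then [Y = X ^ 2 / 2]. *)
Lemma normal_standardized : ('E_P[X] = 0)%E -> ('E_P[fun w => (X w * X w)%R] = 1)%E ->
  m = 0 /\ s ^+ 2 = 1.
Proof.
move=> EX EX2.
have iX2 : P.-integrable setT (fun w => (X w * X w)%:E).
  apply/integrableP; split.
    by apply/measurable_EFinP; exact: measurable_funM.
  under eq_integral do rewrite gee0_abs ?lee_fin -?expr2 ?sqr_ge0//.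
  by move: EX2; rewrite unlock => ->; rewrite ltry.
have iX : P.-integrable setT (EFin \o X).
  have i1 : P.-integrable setT (fun=> 1%:E : \bar R).
    exact: finite_measure_integrable_cst.
  have i2 : P.-integrable setT (fun w => (1 + X w * X w)%:E).
    by under eq_fun do rewrite EFinD; exact: integrableD.
  apply: (le_integrable measurableT _ _ i2); first exact/measurable_EFinP.
  move=> w _ /=; rewrite !lee_fin [leRHS]ger0_norm; last first.
    by rewrite addr_ge0// -expr2 sqr_ge0.
  rewrite -expr2; have := sqr_ge0 (`|X w| - 1).
  rewrite sqrrB1 real_normK ?num_real//; have := normr_ge0 (X w); lra.
have iZ c (Y : T -> R) : P.-integrable setT (fun w => (Y w)%:E) ->
    P.-integrable setT (fun w => (c * Y w)%:E).
  by move=> iY; under eq_fun do rewrite EFinM; exact: integrableZl.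
have m0 : m = 0.
  have mt t : 0 <= m * t + s ^+ 2 * t ^+ 2 / 2.
    have : (1 + t * 0 <= expR (m * t + s ^+ 2 * t ^+ 2 / 2))%R.
      rewrite -lee_fin -mgf EFinD EFinM.
      have <- : (\int[P]_w (X w)%:E = 0%:E)%E by move: EX; rewrite unlock.
      rewrite -integralZl//; under [X in (_ + X)%E]eq_integral do rewrite -EFinM.
      by apply: integral_expR_ge1D; exact: iZ.
    by rewrite mulr0 addr0 -[leLHS]expR0 ler_expR.
  have := mt (- m / s ^+ 2).
  have -> : m * (- m / s ^+ 2) + s ^+ 2 * (- m / s ^+ 2) ^+ 2 / 2 =
      - (m ^+ 2 / (2 * s ^+ 2)) by field.
  rewrite oppr_ge0 pmulr_lle0; last by rewrite invr_gt0 mulr_gt0// exprn_even_gt0.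
  by move=> m2; apply/eqP; rewrite -sqrf_eq0 eq_le m2 sqr_ge0.
split=> //; have v0 : 0 < s ^+ 2 by rewrite exprn_even_gt0.
have vt t : -1 <= t <= 1 -> t * s ^+ 2 < 1 ->
    (1 + t / 2) ^+ 2 * (1 - t * s ^+ 2) <= 1.
  move=> /andP[t1 t2] ts.
  have d0 : 0 < 1 - t * s ^+ 2 by rewrite subr_gt0.
  have : (1 + t / 2 * 1 <= (Num.sqrt (1 - t * s ^+ 2))^-1)%R.
    have -> : (t / 2 * 1 = fine (\int[P]_w (t / 2 * (X w * X w))%:E))%R.
      under eq_integral do rewrite EFinM.
      by rewrite integralZl//; move: EX2; rewrite unlock => ->.
    rewrite -lee_fin -(normal_sqr_mgf m0 ts) EFinD fineK; last first.
      exact/integrable_fin_num/iZ.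
    have e w : t * X w ^+ 2 / 2 = t / 2 * (X w * X w) by field.
    under [X in (_ <= X)%E]eq_integral do rewrite e.
    by apply: integral_expR_ge1D; exact: iZ.
  rewrite mulr1 -[leRHS]mul1r ler_pdivlMr ?sqrtr_gt0// => h.
  rewrite -[X in _ * X <= _](sqr_sqrtr (ltW d0)) -exprMn.
  apply: exprn_ile1 => //; rewrite mulr_ge0 ?sqrtr_ge0//; lra.
move: vt v0; move: (s ^+ 2) => v {EX EX2} vt v0.
apply/eqP; rewrite eq_le; apply/andP; split; rewrite leNgt; apply/negP => v1.
- have v4 : (v - 1) / (4 * v) < 1 / 4 by rewrite ltr_pdivrMr; lra.
  have v4' : 0 < (v - 1) / (4 * v) by rewrite divr_gt0; lra.
  have e : (v - 1) / (4 * v) * v = (v - 1) / 4 by field; rewrite gt_eqF.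
  have := vt (- ((v - 1) / (4 * v))); move: v4 v4' e.
  move: ((v - 1) / (4 * v)) => t v4 v4' e.
  rewrite mulNr e => /(_ _ _)/wrap[]; [lra|lra|] => h.
  have v10 : 0 < v - 1 by lra.
  have tv : 0 < t * (v - 1) by rewrite mulr_gt0.
  have : 0 <= t ^+ 2 * (1 + (v - 1) / 4) by rewrite mulr_ge0 ?sqr_ge0//; lra.
  by nra.
- have u0 : 0 < (1 - v) / 4 by lra.
  have uv : (1 - v) / 4 * v < 1 by nra.
  have := vt ((1 - v) / 4) => /(_ _ _)/wrap[]; [lra|lra|] => h.
  have : 0 <= ((1 - v) / 4) ^+ 2 * (1 - (1 - v) / 4 * v).
    by rewrite mulr_ge0 ?sqr_ge0//; lra.
  have : 0 < ((1 - v) / 4) ^+ 2 by rewrite exprn_gt0.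
  by nra.
Qed.

End law.

Definition std_normal X := forall A : set R, measurable A ->
  P (X @^-1` A) = normal_prob 0 1 A.

Lemma gaussian_std_normal X : gaussian P X -> ('E_P[X] = 0)%E ->
  ('E_P[fun w => (X w * X w)%R] = 1)%E -> std_normal X.
Proof.
move=> [m [s [s0 lawX]]] EX EX2; have [s_eq0|sN0] := eqVneq s 0.
  have Xm (g : R -> R) : measurable_fun [set: R] g ->
      (\int[P]_w (g (X w))%:E = (g m)%:E)%E.
    move=> mg; transitivity (\int[P]_w (cst (g m)%:E w))%E; last first.
      rewrite integral_cst// [X in (_ * X)%E](_ : _ = 1%E) ?mule1//.
      exact: probability_setT.
    apply: ae_eq_integral => //.
      by apply/measurable_EFinP; exact: measurableT_comp.
    exists (X @^-1` (~` [set m])); split.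
    - rewrite -[X in measurable X]setTI; apply: (measurable_funP X) => //.
      exact: measurableC.
    - apply: (etrans (lawX _ _)); first exact: measurableC.
      by rewrite s_eq0 eqxx diracE memNset//= => /(_ erefl).
    - by move=> w /= h; apply: contra_not h => -> _.
  (* a point mass with mean 0 has second moment 0 *)
  exfalso; move: EX EX2; rewrite unlock (Xm id)//= => -[m0].
  rewrite (Xm (fun x => x * x)); last exact: measurable_funM.
  by rewrite m0 mul0r => -[] /esym/eqP; rewrite oner_eq0.
have lawX' A : measurable A -> P (X @^-1` A) = normal_prob m s A.
  by move=> mA; rewrite lawX// (negbTE sN0).
have [m0 s1] := normal_standardized sN0 lawX' EX EX2.
have s_eq1 : s = 1 by apply/eqP; rewrite -(eqrXn2 (n := 2))// s1 expr1n.
by rewrite m0 s_eq1 in lawX'.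
Qed.

Section std.
Variable X : {RV P >-> R}.
Hypothesis hX : std_normal X.

(** The value of [4 / (1 - c) * E exp (c' X ^ 2 / 2)], where [c' = (1 + c) / 2]
    lies between [c] and 1. *)
Definition tail_const (c : R) : R :=
  4 / (1 - c) * (Num.sqrt (1 - (1 + c) / 2 * 1 ^+ 2))^-1.

Lemma tail_const_gt0 c : c < 1 -> 0 < tail_const c.
Proof.
move=> c1; rewrite /tail_const expr1n mulr1 divr_gt0 ?divr_gt0 ?subr_gt0//.
by rewrite sqrtr_gt0; lra.
Qed.

(** On [a <= |X|], insert [exp (c (X ^ 2 - a ^ 2) / 2) >= 1] and absorb the
    factor [X ^ 2] into the slightly larger exponent [(1 + c) / 2]. *)
Lemma std_normal_tail (c a : R) : 0 < c < 1 -> 0 <= a ->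
  (\int[P]_w (X w ^+ 2 * (a <= `|X w|)%R%:R)%:E
     <= (tail_const c * expR (- (c * a ^+ 2 / 2)))%:E)%E.
Proof.
move=> /andP[c0 c1] a0; pose c' := (1 + c) / 2.
have c'1 : c' * 1 ^+ 2 < 1 by rewrite expr1n mulr1 /c'; lra.
pose K := 4 / (1 - c) * expR (- (c * a ^+ 2 / 2)).
have K0 : 0 <= K by rewrite mulr_ge0 ?expR_ge0// divr_ge0// subr_ge0 ltW.
have mX2 : measurable_fun setT (fun w => expR (c' * X w ^+ 2 / 2)).
  apply: measurableT_comp => //; apply: measurable_funM => //.
  by apply: measurable_funM => //; exact: measurable_funX.
apply: (@le_trans _ _ (\int[P]_w (K * expR (c' * X w ^+ 2 / 2))%:E)%E); last first.
  under eq_integral do rewrite EFinM.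
  rewrite ge0_integralZl//; last exact/measurable_EFinP.
  rewrite (normal_sqr_mgf (oner_neq0 R) hX)// -EFinM lee_fin /tail_const /K.
  by rewrite -/c' mulrAC.
apply: ge0_le_integral => //.
- by move=> w _; rewrite lee_fin mulr_ge0 ?sqr_ge0.
- apply/measurable_EFinP; apply: measurable_funM; first exact: measurable_funX.
  apply: (@measurableT_comp _ _ _ _ _ _ (fun b : bool => b%:R : R)) => //.
  by apply: measurable_fun_ler => //; exact: measurableT_comp.
- by apply/measurable_EFinP; exact: measurable_funM.
move=> w _; rewrite lee_fin; case: (leP a `|X w|) => h; last first.
  by rewrite mulr0 mulr_ge0 ?expR_ge0.
rewrite mulr1 /K -mulrA -expRD.
have aX : a ^+ 2 <= X w ^+ 2 by rewrite -(real_normK (num_real (X w))) lerXn2r ?nnegrE.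
have {1}-> : X w ^+ 2 = 4 / (1 - c) * ((1 - c) / 4 * X w ^+ 2).
  by field; rewrite subr_eq0 gt_eqF.
apply: ler_wpM2l; first by rewrite divr_ge0// subr_ge0 ltW.
apply: (@le_trans _ _ (expR ((1 - c) / 4 * X w ^+ 2))).
  by rewrite (le_trans _ (expR_ge1Dx _))// lerDr.
by have := ler_wpM2l (ltW c0) aX; rewrite ler_expR /c'; lra.
Qed.

Lemma std_normal_small_ball (a : R) : 0 < a ->
  ((a * normal_pdf 0 1 a)%:E <= P (X @^-1` `]0%R, a[))%E /\
  ((a * normal_pdf 0 1 a)%:E <= P (X @^-1` `](- a)%R, 0%R[))%E.
Proof.
move=> a0.
have main (I : interval R) : lebesgue_measure [set` I] = a%:E ->
    (forall x, x \in I -> `|x| <= a) ->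
    ((a * normal_pdf 0 1 a)%:E <= P (X @^-1` [set` I]))%E.
  move=> lI Ia; rewrite hX// /normal_prob.
  rewrite mulrC EFinM -lI -integral_cst//.
  apply: ge0_le_integral => //.
  - by move=> x _; rewrite lee_fin normal_pdf_ge0.
  - apply/measurable_EFinP/measurable_funTS; exact: measurable_normal_pdf.
  move=> x /= xI; rewrite lee_fin !normal_pdfE//.
  rewrite ler_wpM2l ?normal_peak_ge0// /normal_fun ler_expR.
  rewrite !subr0 ler_wpM2r ?invr_ge0// ?mulrn_wge0//.
  rewrite lerN2 -(real_normK (num_real x)) lerXn2r ?nnegrE//; last exact: Ia.
  exact: ltW.
split.
- apply: (main `]0, a[).
    by rewrite lebesgue_measure_itv/= lte_fin a0 -EFinB subr0.
  by move=> x; rewrite in_itv/= => /andP[x0 xa]; rewrite gtr0_norm// ltW.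
- apply: (main `](- a), 0[).
    by rewrite lebesgue_measure_itv/= lte_fin oppr_lt0 a0 -EFinB sub0r opprK.
  by move=> x; rewrite in_itv/= => /andP[x0 xa]; rewrite ltr0_norm//; lra.
Qed.

End std.
End gauss_rv.

(** * Orthonormal families in L2 *)

Section L2_inner_product.
Context {R : realType}.
Variables (D : set R) (mD : measurable D).
Local Notation leb := (@lebesgue_measure R).
Implicit Types (f g h : R -> R).

Lemma L2_integrableM f g : L2 D f -> L2 D g ->
  leb.-integrable D (fun x => (f x * g x)%:E).
Proof.
move=> [mf f2] [mg g2].
have i2 : leb.-integrable D (fun x => (f x ^+ 2 + g x ^+ 2)%:E).
  by under eq_fun do rewrite EFinD; exact: integrableD.
apply: le_integrable i2 => //.
  by apply/measurable_EFinP; exact: measurable_funM.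
move=> x _; rewrite lee_fin [leRHS]ger0_norm ?addr_ge0 ?sqr_ge0//.
rewrite normrM -(real_normK (num_real (f x))) -(real_normK (num_real (g x))).
have := sqr_ge0 (`|f x| - `|g x|); rewrite sqrrB.
have := mulr_ge0 (normr_ge0 (f x)) (normr_ge0 (g x)); lra.
Qed.

Lemma L2_lin a f g : L2 D f -> L2 D g -> L2 D (fun x => a * f x + g x).
Proof.
move=> Lf Lg; have [mf f2] := Lf; have [mg g2] := Lg; split.
  by apply: measurable_funD => //; exact: measurable_funM.
have -> : (fun x => ((a * f x + g x) ^+ 2)%:E) =
    (fun x => (a ^+ 2)%:E * (f x ^+ 2)%:E
              + ((2 * a)%:E * (f x * g x)%:E + (g x ^+ 2)%:E))%E.
  by apply/funext => x; rewrite -!EFinM -!EFinD; congr EFin; ring.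
apply: integrableD => //; first exact: integrableZl.
by apply: integrableD => //; apply: integrableZl => //; exact: L2_integrableM.
Qed.

Lemma L2_cst0 : L2 D (fun=> 0).
Proof.
split; first exact: measurable_cst.
by under eq_fun do rewrite expr0n/=; exact: integrable0.
Qed.

Lemma L2_sum (K : Type) (r : seq K) (c : K -> R) (e : K -> R -> R) :
  (forall k, L2 D (e k)) -> L2 D (fun x => \sum_(k <- r) c k * e k x).
Proof.
move=> Le; elim: r => [|k r IH].
  by under eq_fun do rewrite big_nil; exact: L2_cst0.
by under eq_fun do rewrite big_cons; exact: L2_lin.
Qed.

Lemma ipC f g : ip D f g = ip D g f.
Proof. by apply: eq_Rintegral => x _; rewrite mulrC. Qed.

Lemma ip_lin a f g h : L2 D f -> L2 D g -> L2 D h ->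
  ip D (fun x => a * f x + g x) h = a * ip D f h + ip D g h.
Proof.
move=> Lf Lg Lh; rewrite /ip -RintegralZl//; last exact: L2_integrableM.
rewrite -RintegralD//.
- by apply: eq_Rintegral => x _; ring.
- have : leb.-integrable D (fun x => (a * (f x * h x))%:E); last exact.
  by under eq_fun do rewrite EFinM; apply: integrableZl => //; exact: L2_integrableM.
- exact: L2_integrableM.
Qed.

Lemma ip_cst0 h : ip D (fun=> 0) h = 0.
Proof.
rewrite /ip; under eq_Rintegral do rewrite mul0r.
by rewrite Rintegral_cst// mul0r.
Qed.

Lemma ip_sum (K : Type) (r : seq K) (c : K -> R) (e : K -> R -> R) h :
  (forall k, L2 D (e k)) -> L2 D h ->
  ip D (fun x => \sum_(k <- r) c k * e k x) h = \sum_(k <- r) c k * ip D (e k) h.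
Proof.
move=> Le Lh; elim: r => [|k r IH].
  by rewrite big_nil; under [X in ip D X _]eq_fun do rewrite big_nil;
     exact: ip_cst0.
rewrite big_cons -IH -ip_lin//; last exact: L2_sum.
by congr ip; apply/funext => x; rewrite big_cons.
Qed.

Lemma norm2_sqr f : norm2 D f ^+ 2 = ip D f f.
Proof.
rewrite sqr_sqrtr//; apply: Rintegral_ge0 => x _; exact: sqr_ge0.
Qed.

Lemma norm2_sqr_sub f g : L2 D f -> L2 D g ->
  norm2 D (f \- g) ^+ 2 = ip D f f - 2 * ip D f g + ip D g g.
Proof.
move=> Lf Lg; rewrite norm2_sqr.
have e : f \- g = (fun x => -1 * g x + f x) by apply/funext => x /=; ring.
have Lfg : L2 D (f \- g) by rewrite e; exact: L2_lin.
rewrite {1}e ip_lin// ![ip D _ (f \- g)]ipC e !ip_lin// (ipC g f); ring.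
Qed.

Section orthonormal_family.
Variables (K : finType) (e : K -> R -> R).
Hypothesis Le : forall k, L2 D (e k).
Hypothesis oe : forall i j, ip D (e i) (e j) = (i == j)%:R.

(** Canonical form of the elements of the span: one coefficient for each
    member of the family. *)
Definition lincomb (c : K -> R) : R -> R := fun x => \sum_k c k * e k x.

Lemma L2_lincomb c : L2 D (lincomb c). Proof. exact: L2_sum. Qed.

Lemma ip_lincombl c h : L2 D h -> ip D (lincomb c) h = \sum_k c k * ip D (e k) h.
Proof. exact: ip_sum. Qed.

Lemma ip_lincomb_e c k : ip D (lincomb c) (e k) = c k.
Proof.
rewrite ip_lincombl// (bigD1 k)//= oe eqxx mulr1 big1 ?addr0// => i ik.
by rewrite oe (negbTE ik) mulr0.
Qed.

Lemma norm2_sqr_lincomb c : norm2 D (lincomb c) ^+ 2 = \sum_k c k ^+ 2.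
Proof.
rewrite norm2_sqr ip_lincombl; last exact: L2_lincomb.
by apply: eq_bigr => k _; rewrite ipC ip_lincomb_e expr2.
Qed.

(** Pythagoras: the squared distance to [s] splits into the error on the
    coefficients and the squared distance from [s] to the span. *)
Lemma norm2_lincomb_sub c s : L2 D s ->
  norm2 D (lincomb c \- s) ^+ 2 =
  \sum_k (c k - ip D s (e k)) ^+ 2 +
  (ip D s s - \sum_k ip D s (e k) ^+ 2).
Proof.
move=> Ls; rewrite norm2_sqr_sub//; last exact: L2_lincomb.
rewrite -norm2_sqr norm2_sqr_lincomb ip_lincombl// mulr_sumr.
have -> : \sum_k (c k - ip D s (e k)) ^+ 2 = \sum_k c k ^+ 2
    - \sum_k 2 * (c k * ip D (e k) s) + \sum_k ip D s (e k) ^+ 2.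
  rewrite -sumrB -big_split/=; apply: eq_bigr => k _; rewrite (ipC (e k)); ring.
ring.
Qed.

Lemma bessel s : L2 D s -> 0 <= ip D s s - \sum_k ip D s (e k) ^+ 2.
Proof.
move=> Ls; have := sqr_ge0 (norm2 D (lincomb (fun k => ip D s (e k)) \- s)).
by rewrite norm2_lincomb_sub// big1 ?add0r// => k _; rewrite subrr expr0n.
Qed.

Lemma lin_spanP (A : set K) u : lin_span (e @` A) u <->
  exists2 c : K -> R, (forall k, ~ A k -> c k = 0) & u = lincomb c.
Proof.
split=> [[N [f [a [fA ->]]]]|[c c0 ->]].
  have /choice[i iP] : forall l, exists k, A k /\ e k = f l.
    by move=> l; have [k Ak ek] := fA l; exists k.
  exists (fun k => \sum_(l | i l == k) a l).
    move=> k Ak; rewrite big1// => l /eqP il.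
    by case: Ak; rewrite -il; case: (iP l).
  apply/funext => x; rewrite /lincomb (partition_big i xpredT)//=.
  apply: eq_bigr => k _; rewrite mulr_suml; apply: eq_bigr => l /eqP <-.
  by rewrite (iP l).2.
pose B := [set k | k \in A]%SET; pose b := enum B.
exists (size b), (fun l => e (tnth (in_tuple b) l)), (fun l => c (tnth (in_tuple b) l)).
split=> [l|].
  exists (tnth (in_tuple b) l) => //.
  by have := mem_tnth l (in_tuple b); rewrite mem_enum inE => /set_mem.
apply/funext => x.
rewrite -(big_tuple _ _ (in_tuple b) xpredT (fun k => c k * e k x))/=.
rewrite big_enum/= /lincomb [LHS](bigID (mem B))/= [X in _ + X]big1 ?addr0// => k.
by rewrite inE => kA; rewrite c0 ?mul0r// => /mem_set; exact/negP.
Qed.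

(** The coordinates of the members of a basis of the span, in the orthonormal
    family, form a matrix that is both row-free (the basis is independent) and
    row-full (it spans), hence square. *)
Lemma dimension_lin_span : dimension D (lin_span (range e)) = #|K|.
Proof.
have spanP u : lin_span (range e) u <-> exists c, u = lincomb c.
  rewrite lin_spanP; split=> [[c _ ->]|[c ->]]; first by exists c.
  by exists c => // k; case.
have coord0 c : norm2 D (lincomb c) = 0 -> forall k, c k = 0.
  move=> /(congr1 (fun x => x ^+ 2)); rewrite norm2_sqr_lincomb expr0n/=.
  move=> /eqP; rewrite psumr_eq0; last by move=> *; exact: sqr_ge0.
  by move=> /allP h k; apply/eqP; rewrite -sqrf_eq0; exact: h (mem_index_enum k).
have uniq N (f : 'I_N -> R -> R) :
    finite_basis D (lin_span (range e)) f -> N = #|K|.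
  move=> [fV f_free f_span].
  have /choice[F FE] : forall i, exists c, f i = lincomb c.
    by move=> i; apply/spanP.
  have comb c : (fun x => \sum_(i < N) c i * f i x) =
      lincomb (fun k => \sum_i c i * F i k).
    apply/funext => x; rewrite /lincomb.
    under [RHS]eq_bigr do rewrite mulr_suml.
    rewrite exchange_big/=; apply: eq_bigr => i _.
    by rewrite FE /lincomb mulr_sumr; apply: eq_bigr => k _; rewrite mulrA.
  pose M := \matrix_(i < N, j < #|K|) F i (enum_val j).
  have freeM : row_free M.
    apply/inj_row_free => v vM; apply/rowP => i; rewrite mxE.
    apply: (f_free (fun i => v 0 i)).
    rewrite comb (_ : (fun k => _) = fun=> 0).
      by apply/eqP; rewrite -sqrf_eq0 norm2_sqr_lincomb big1// => k _; rewrite expr0n.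
    apply/funext => k; have /rowP/(_ (enum_rank k)) := vM; rewrite !mxE => vMk.
    rewrite -[RHS]vMk; apply: eq_bigr => j _; rewrite mxE enum_rankK//.
  have fullM : row_full M.
    rewrite -sub1mx; apply/row_subP => j.
    have /f_span[c hc] : lin_span (range e) (e (enum_val j)).
      by exists 1%N, (fun=> e (enum_val j)), (fun=> 1); split=> [_|];
        [exists (enum_val j)|apply/funext => x; rewrite big_ord1 mul1r].
    apply/submxP; exists (\row_i c i); apply/rowP => l; rewrite !mxE.
    have dE : e (enum_val j) = lincomb (fun k => (k == enum_val j)%:R).
      apply/funext => x; rewrite /lincomb (bigD1 (enum_val j))//= eqxx mul1r.
      by rewrite big1 ?addr0// => k /negbTE ->; rewrite mul0r.
    have /coord0/(_ (enum_val l)) : norm2 D (lincomb (fun k =>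
        (k == enum_val j)%:R - \sum_i c i * F i k)) = 0.
      rewrite -[RHS]hc comb dE; congr norm2; apply/funext => x /=.
      by rewrite /lincomb -sumrB; apply: eq_bigr => k _; rewrite mulrBl.
    rewrite (inj_eq enum_val_inj) eq_sym => /eqP; rewrite subr_eq0 => /eqP ->.
    by apply: eq_bigr => i _; rewrite !mxE.
  by have /eqP <- := freeM; have /eqP -> := fullM.
rewrite /dimension; case: xgetP => [N -> [f /uniq//]|] none; exfalso.
apply: (none #|K|); exists (e \o enum_val); split.
- by move=> k; apply/spanP; exists (fun i => (i == enum_val k)%:R);
  apply/funext => x; rewrite /lincomb (bigD1 (enum_val k))//= eqxx mul1r;
  rewrite big1 ?addr0// => i /negbTE ->; rewrite mul0r.
- move=> c; rewrite (_ : (fun x => _) = lincomb (c \o enum_rank)).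
    by move=> /coord0 h k; have := h (enum_val k); rewrite /= enum_valK.
  apply/funext => x; rewrite /lincomb (reindex (@enum_val K K))/=.
    by apply: eq_bigr => k _; rewrite /= enum_valK.
  exact: onW_bij (enum_val_bij K).
- move=> v /spanP[c ->]; exists (c \o enum_val).
  apply/eqP; rewrite -sqrf_eq0 norm2_sqr.
  rewrite (_ : _ \- _ = fun=> 0); first by rewrite ip_cst0.
  apply/funext => x /=; rewrite /lincomb (reindex (@enum_val K K))/= ?subrr//.
  exact: onW_bij (enum_val_bij K).
Qed.

End orthonormal_family.
End L2_inner_product.

(** * Model selection over all subsets *)

Lemma sum_option (V : nmodType) (S : finType) (Q : pred (option S))
    (F : option S -> V) : Q None ->
  \sum_(k | Q k) F k = F None + \sum_(i | Q (Some i)) F (Some i).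
Proof.
move=> QN; rewrite (bigD1 None)//=; congr (_ + _).
rewrite (reindex_omap Some id)/=; last by case=> //; rewrite andbF.
by apply: eq_bigl => i; rewrite eqxx !andbT.
Qed.

Section submodels.
Context {R : realType}.
Variables (S : finType) (e : option S -> R -> R).
Hypothesis Le : forall k, L2 `[0, 1] (e k).
Hypothesis oe : forall i j, ip `[0, 1] (e i) (e j) = (i == j)%:R.

Let mD : measurable (`[0, 1]%classic : set R). Proof. exact: measurable_itv. Qed.

(** [None] stands for the father wavelet, which belongs to every model. *)
Definition selected (A : {set S}) (k : option S) : bool :=
  if k is Some i then i \in A else true.

Definition submodel (A : {set S}) : set (R -> R) :=
  lin_span (e @` [set k | selected A k]).

Lemma submodelP A u : submodel A u <->
  exists2 c : option S -> R, (forall k, ~~ selected A k -> c k = 0)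
                           & u = lincomb e c.
Proof.
rewrite /submodel lin_spanP; split=> -[c c0 ->]; exists c => // k.
  by move=> kA; apply: c0; exact/negP.
by move/negP/c0.
Qed.

Lemma big_selected A (F : option S -> R) :
  \sum_(k | selected A k) F k = F None + \sum_(i in A) F (Some i).
Proof. by rewrite sum_option. Qed.

Lemma submodel_inj : injective submodel.
Proof.
have sub A B : submodel A = submodel B -> A \subset B.
  move=> AB; apply/fintype.subsetP => i iA.
  have : submodel A (e (Some i)).
    apply/submodelP; exists (fun k => (k == Some i)%:R) => [k|].
      by case: eqVneq => //= ->; rewrite /= iA.
    apply/funext => x; rewrite /lincomb (bigD1 (Some i))//= eqxx mul1r.
    by rewrite big1 ?addr0// => k /negbTE ->; rewrite mul0r.
  rewrite AB => /submodelP[c c0 ec]; apply/negPn/negP => iB.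
  have := c0 (Some i) iB; rewrite -(ip_lincomb_e mD Le oe c (Some i)) -ec oe eqxx.
  by move/eqP; rewrite oner_eq0.
by move=> A B AB; apply/eqP; rewrite finset.eqEsubset !sub.
Qed.

Lemma dimension_submodel A : dimension `[0, 1] (submodel A) = #|A|.+1.
Proof.
pose K := option {i | i \in A}; pose f (k : K) := e (omap val k).
have -> : submodel A = lin_span (range f).
  congr lin_span; apply/seteqP; split=> u /= [k].
    case: k => [i /= iA|_] <-; last by exists None.
    by exists (Some (Sub i iA)).
  by move=> _ <-; exists (omap val k) => //; case: k => //= -[].
rewrite (dimension_lin_span mD); first by rewrite card_option card_sig.
- by move=> k; exact: Le.
- move=> i j; rewrite oe; congr (_%:R); congr nat_of_bool.
  by rewrite (inj_eq (inj_omap val_inj)).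
Qed.

Section contrast.
Variable y : (R -> R) -> R.
Hypothesis y_lin : forall c, y (lincomb e c) = \sum_k c k * y (e k).

Definition projection (A : {set S}) : R -> R :=
  lincomb e (fun k => if selected A k then y (e k) else 0).

Lemma contrast_lincomb A c : (forall k, ~~ selected A k -> c k = 0) ->
  contrast y (lincomb e c) =
  \sum_(k | selected A k) (c k - y (e k)) ^+ 2
  - \sum_(k | selected A k) y (e k) ^+ 2.
Proof.
move=> c0; rewrite /contrast y_lin norm2_sqr_lincomb// mulr_sumr -big_split/=.
rewrite (bigID (selected A))/= [X in _ + X]big1 ?addr0 => [|k /c0 ->]; last ring.
by rewrite -sumrB; apply: eq_bigr => k _; ring.
Qed.

Lemma contrast_projection A :
  contrast y (projection A) = - \sum_(k | selected A k) y (e k) ^+ 2.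
Proof.
rewrite (@contrast_lincomb A) => [|k /negbTE->//].
by rewrite big1 ?add0r// => k ->; rewrite subrr expr0n.
Qed.

Lemma contrast_minimizer A u : submodel A u ->
  (forall v, submodel A v -> contrast y u <= contrast y v) -> u = projection A.
Proof.
move=> /submodelP[c c0 ->] cmin.
have /cmin : submodel A (projection A).
  by apply/submodelP; eexists; last by []; move=> k /negbTE ->.
rewrite contrast_projection (contrast_lincomb c0) -[leRHS]add0r lerD2r => h.
have /eqP : \sum_(k | selected A k) (c k - y (e k)) ^+ 2 = 0.
  by apply/eqP; rewrite eq_le h sumr_ge0// => *; exact: sqr_ge0.
rewrite psumr_eq0 => [/allP cy|*]; last exact: sqr_ge0.
rewrite /projection; congr lincomb; apply/funext => k.
case: ifPn => [kA|/c0//]; apply/eqP; rewrite -subr_eq0 -sqrf_eq0.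
exact: (implyP (cy k (mem_index_enum k))).
Qed.

(** Adding or removing the coordinate [i] changes the criterion by
    [pen - y i ^ 2] or its opposite, so a minimizer over all subsets decides each
    coordinate separately. In case of a tie either decision is possible. *)
Lemma penalized_minimizer (pen : R) shat A :
  (forall B, submodel B (shat (submodel B) y) /\
     forall u, submodel B u -> contrast y (shat (submodel B) y) <= contrast y u) ->
  (forall B, penalized_contrast pen shat y (submodel A)
             <= penalized_contrast pen shat y (submodel B)) ->
  shat (submodel A) y = projection A /\
  forall i, if i \in A then pen <= y (e (Some i)) ^+ 2
            else y (e (Some i)) ^+ 2 <= pen.
Proof.
move=> hs hA.
have sE B : shat (submodel B) y = projection B.
  by have [sB mB] := hs B; exact: contrast_minimizer.
split=> // i; have crit B : penalized_contrast pen shat y (submodel B) =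
    - (y (e None) ^+ 2 + \sum_(i in B) y (e (Some i)) ^+ 2) + pen * #|B|.+1%:R.
  by rewrite /penalized_contrast sE contrast_projection dimension_submodel
             big_selected.
case: ifPn => iA.
- have := hA (A :\ i); rewrite !crit (cardsD1 i A) iA.
  rewrite (big_setD1 i iA)/= add1n -[in leLHS]natr1; lra.
- have := hA (i |: A); rewrite !crit cardsU1 iA big_setU1// add1n -[in leRHS]natr1.
  by rewrite /=; lra.
Qed.

Lemma norm2_projection_sub A s : L2 `[0, 1] s ->
  norm2 `[0, 1] (projection A \- s) ^+ 2 =
  (y (e None) - ip `[0, 1] s (e None)) ^+ 2 +
  \sum_i ((if i \in A then y (e (Some i)) else 0) - ip `[0, 1] s (e (Some i))) ^+ 2
  + (ip `[0, 1] s s - \sum_k ip `[0, 1] s (e k) ^+ 2).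
Proof.
move=> Ls; rewrite norm2_lincomb_sub//; congr (_ + _).
have -> : \sum_k ((if selected A k then y (e k) else 0)
                  - ip `[0, 1] s (e k)) ^+ 2 =
    \sum_(k | selected [set: S]%SET k) ((if selected A k then y (e k) else 0)
                  - ip `[0, 1] s (e k)) ^+ 2.
  by apply: eq_bigl => -[i|] //=; rewrite inE.
rewrite big_selected/=; congr (_ + _); apply: eq_bigl => i; exact: finset.in_setT.
Qed.

End contrast.
End submodels.

(** * Wavelet coefficients by level *)

Definition detail (J : nat) : finType := {j : 'I_J & 'I_(2 ^ j)}.

Definition detail_index J (i : detail J) : nat * nat :=
  (tag i : nat, tagged i : nat).

Lemma detail_index_inj J : injective (@detail_index J).
Proof.
move=> [j k] [j' k'] [/= /val_inj jj']; case: _ / jj' k' => k' /val_inj -> //.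
Qed.

Lemma detail_indexP J jk : (jk.1 < J)%N -> (jk.2 < 2 ^ jk.1)%N ->
  exists i : detail J, detail_index i = jk.
Proof.
case: jk => j k /= jJ kj.
by exists (existT (fun j : 'I_J => 'I_(2 ^ j)) (Ordinal jJ) (Ordinal kj)).
Qed.

Lemma sum_detail (R : nmodType) J (F : nat * nat -> R) :
  \sum_(i : detail J) F (detail_index i) =
  \sum_(j < J) \sum_(k < 2 ^ j) F (j : nat, k : nat).
Proof.
by rewrite (sig_big_dep xpredT (fun _ => xpredT) (fun j k => F (val j, val k))).
Qed.

Lemma card_detail J : #|detail J| = (2 ^ J).-1.
Proof.
rewrite -sum1_card (sum_detail J (fun=> 1%N)).
elim: J => [|J IH]; first by rewrite big_ord0.
rewrite big_ord_recr/= IH sum1_card card_ord expnS mul2n -addnn.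
by have := expn_gt0 2 J; case: (2 ^ J)%N.
Qed.

(** Levels are natural numbers but [j0 n] is an integer, and there is no detail
    when it is negative. *)
Definition nlevels (J : int) : nat := if J is Posz n then n else 0.

Lemma lt_nlevels (j : nat) (J : int) : (j%:Z < J)%R = (j < nlevels J)%N.
Proof. by case: J => [n|n]; rewrite /= ?ltz_nat. Qed.

Section wavelets.
Context {R : realType}.
Variables (phi psi : R -> R).
Hypothesis onb : orthonormal_basis `[0, 1] (L2 `[0, 1]) wavelet_index
                   (wavelet_family phi psi).

Let mD : measurable (`[0, 1]%classic : set R). Proof. exact: measurable_itv. Qed.

Definition wavelets_below J (k : option (detail J)) : R -> R :=
  wavelet_family phi psi (omap (@detail_index J) k).

Lemma wavelet_index_detail J (k : option (detail J)) :
  wavelet_index (omap (@detail_index J) k).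
Proof. by case: k => [[j k]|]//=; exact: ltn_ord. Qed.

Lemma L2_wavelets_below J k : L2 `[0, 1] (@wavelets_below J k).
Proof. by case: onb => h _ _; apply: h; exact: wavelet_index_detail. Qed.

Lemma wavelets_below_orthonormal J i j :
  ip `[0, 1] (@wavelets_below J i) (wavelets_below j) = (i == j)%:R.
Proof.
case: onb => _ h _; rewrite h; [|exact: wavelet_index_detail..].
by rewrite (inj_eq (inj_omap (@detail_index_inj J))).
Qed.

(** This transports sums over the collection to sums over the subsets of a
    finite type. *)
Lemma models_submodel (J : int) :
  models phi psi J = range (submodel (@wavelets_below (nlevels J))).
Proof.
pose L := nlevels J.
have img (A : {set detail L}) : submodel (@wavelets_below L) A =
    model phi psi (@detail_index L @` [set` A]).
  congr lin_span; apply/seteqP; split=> u /=.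
    move=> [[i iA|_] <-]; last by exists None => //; left.
    exists (Some (detail_index i)) => //; right.
    by exists (detail_index i) => //; exists i.
  move=> [k [->|[jk [i iA <-] <-]] <-]; first by exists None.
  by exists (Some i).
apply/seteqP; split=> m /=.
  move=> [I IJ ->]; exists [set i | `[< I (detail_index i) >]]%SET => //.
  rewrite img; congr model; apply/seteqP; split=> jk.
    by move=> [i /=]; rewrite inE => /asboolP h <-.
  move=> Ijk; have [] := IJ _ Ijk; rewrite lt_nlevels => j1 j2.
  have [i iE] := detail_indexP j1 j2.
  by exists i => //=; rewrite inE; apply/asboolP; rewrite iE.
move=> [A _ <-]; rewrite img; exists (@detail_index L @` [set` A]) => //.
move=> jk [[j k] _ <-] /=; split; last exact: ltn_ord.
by rewrite lt_nlevels ltn_ord.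
Qed.

Variable s : R -> R.
Hypothesis Ls : L2 `[0, 1] s.

Definition level_energy (j : nat) : R := \sum_(k < 2 ^ j) beta psi s j k ^+ 2.

Definition coef J (i : detail J) : R := ip `[0, 1] s (wavelets_below (Some i)).

(** The squared distance from [s] to the span of the levels below [J]. *)
Definition residual (J : nat) : R :=
  ip `[0, 1] s s - \sum_(k : option (detail J)) ip `[0, 1] s (wavelets_below k) ^+ 2.

Lemma level_energy_ge0 j : 0 <= level_energy j.
Proof. by rewrite sumr_ge0// => *; exact: sqr_ge0. Qed.

Lemma sum_beta2 J :
  \sum_(i : detail J) beta psi s (detail_index i).1 (detail_index i).2 ^+ 2
  = \sum_(0 <= j < J) level_energy j.
Proof.
by rewrite (sum_detail J (fun jk => beta psi s jk.1 jk.2 ^+ 2)) big_mkord.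
Qed.

Lemma residualE J : residual J =
  ip `[0, 1] s s - ip `[0, 1] s (wavelet_family phi psi None) ^+ 2
  - \sum_(0 <= j < J) level_energy j.
Proof.
rewrite /residual -sum_beta2 sum_option//= opprD addrA//.
Qed.

Lemma residual_ge0 J : 0 <= residual J.
Proof. exact: (bessel mD (@L2_wavelets_below J) (@wavelets_below_orthonormal J)). Qed.

(** An element of the dense span uses finitely many wavelets, so it lies in the
    span of the levels below some [J], where the projection of [s] is at least
    as close to [s]. *)
Lemma residual_cvg0 : residual J @[J --> \oo] --> (0 : R).
Proof.
have [_ _ dense] := onb.
apply/cvgrPdist_lt => eps eps0.
have sq0 : 0 < Num.sqrt eps by rewrite sqrtr_gt0.
have [u [N [e [c [eW ->]]]] su] := dense _ Ls _ sq0.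
have /choice[i iP] : forall k, exists i,
    wavelet_index i /\ wavelet_family phi psi i = e k.
  by move=> k; have [i iw ie] := eW k; exists i.
pose lev (o : option (nat * nat)) := if o is Some jk then jk.1.+1 else 0%N.
exists (\max_(k < N) lev (i k)) => // J /= NJ.
rewrite sub0r normrN ger0_norm ?residual_ge0//.
have [c' _ uE] : exists2 c' : option (detail J) -> R,
    (forall k, ~ setT k -> c' k = 0) &
    (fun x => \sum_(k < N) c k * e k x) = lincomb (@wavelets_below J) c'.
  apply/lin_spanP; exists N, e, c; split=> // k.
  have [iw <-] := iP k.
  have : (lev (i k) <= J)%N by apply: leq_trans NJ; exact: (leq_bigmax k).
  case: (i k) iw => [[j l] /= lj jJ|_ _]; last by exists None.
  have [i' i'E] := detail_indexP (jk := (j, l)) jJ lj.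
  exists (Some i') => //.
  exact: (congr1 (wavelet_family phi psi \o Some) i'E).
move: su; rewrite uE => su.
have : norm2 `[0, 1] (lincomb (@wavelets_below J) c' \- s) ^+ 2 < eps.
  have -> : norm2 `[0, 1] (lincomb (@wavelets_below J) c' \- s) =
      norm2 `[0, 1] (s \- lincomb (@wavelets_below J) c').
    rewrite /norm2; congr Num.sqrt; apply: eq_Rintegral => x _ /=; ring.
  rewrite -[ltRHS]sqr_sqrtr ?(ltW eps0)// ltr_sqr ?nnegrE ?sqrtr_ge0//.
rewrite (norm2_lincomb_sub mD (@L2_wavelets_below J) (@wavelets_below_orthonormal J))//.
apply: le_lt_trans; rewrite lerDr sumr_ge0// => *; exact: sqr_ge0.
Qed.

(** Parseval's identity for the levels from [J] on: the partial sums telescope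
    as [residual J - residual n]. *)
Lemma tail_series J :
  (\sum_(J <= j <oo) (level_energy j)%:E = (residual J)%:E)%E.
Proof.
apply/cvg_lim => //.
have : ((residual J - residual n)%:E @[n --> \oo] --> (residual J - 0)%:E)%E.
  apply: cvg_EFin; first exact: nearW.
  by apply: cvgB; [exact: cvg_cst|exact: residual_cvg0].
rewrite subr0; apply: cvg_trans; apply: near_eq_cvg.
near=> n; rewrite sumEFin; congr EFin.
rewrite !residualE (@big_cat_nat _ _ _ J 0 n)//=; first ring.
by near: n; exact: nbhs_infty_ge.
Unshelve. all: by end_near.
Qed.

End wavelets.

(** * Counts of large terms and energies of small terms *)

Section powers.
Context {R : realType}.
Implicit Types (t a q X : R).

Lemma powR2_lt1 a : 0 < a -> (2 : R) `^ (- a) < 1.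
Proof.
move=> a0; rewrite powRN invf_lt1 ?powR_gt0//.
have : (1 : R) `^ a < 2 `^ a by rewrite gt0_ltr_powR// ?nnegrE// ltr1n.
by rewrite powR1.
Qed.

Lemma powR_half t q : 0 < t -> (t / 2) `^ q = 2 `^ (- q) * t `^ q.
Proof.
move=> t0; rewrite powRM ?invr_ge0 ?(ltW t0)// mulrC; congr (_ * _).
by rewrite -powR_inv1// -powRrM mulN1r.
Qed.

Lemma powR_2B t q : 0 < t -> t `^ (2 - q) = t ^+ 2 * t `^ (- q).
Proof.
by move=> t0; rewrite powRD ?powR_mulrn ?(ltW t0)//; apply/implyP => _; rewrite gt_eqF.
Qed.

Lemma powR_exp2V (J : nat) a :
  ((2 : R) `^ (2 * J%:R * a))^-1 = (2 ^+ J)^-1 `^ (2 * a).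
Proof.
rewrite -powR_mulrn// -[in RHS]powRN -powRrM mulNr powRN.
by congr (_ `^ _)^-1; ring.
Qed.

Lemma exp2_unbounded X : exists k : nat, X < 2 ^+ k.
Proof.
have [X0|X0] := ltP X 0; first by exists 0%N; rewrite expr0; lra.
exists (Num.bound X); apply: lt_le_trans (archi_boundP X0) _.
by rewrite -natrX ler_nat ltnW// ltn_expl.
Qed.

End powers.

Section finite_families.
Context {R : realType}.
Variables (S : finType) (b : S -> R).

Definition small_energy (t : R) : R := \sum_(i | `|b i| <= t) b i ^+ 2.

Definition exceedances (u : R) : nat := #|[set i | u < `|b i|]%SET|.

Lemma small_energy_ge0 t : 0 <= small_energy t.
Proof. by rewrite sumr_ge0// => *; exact: sqr_ge0. Qed.

Lemma sum_pred_const (Q : pred S) (c : R) :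
  \sum_(i | Q i) c = #|[set i | Q i]%SET|%:R * c.
Proof.
by rewrite mulr_natl -sumr_const; apply: eq_bigl => i; rewrite inE.
Qed.

Lemma small_energy_halve t : 0 < t ->
  small_energy t <= small_energy (t / 2) + (exceedances (t / 2))%:R * t ^+ 2.
Proof.
move=> t0; rewrite /small_energy (bigID (fun i => `|b i| <= t / 2))/= lerD//.
  rewrite le_eqVlt; apply/orP; left; apply/eqP; apply: eq_bigl => i.
  by apply/andP/idP => [[]//|h]; split=> //; apply: le_trans h _; lra.
rewrite -sum_pred_const [leRHS](bigID (fun i => `|b i| <= t))/= -[leLHS]addr0.
apply: lerD; last by apply: sumr_ge0 => *; exact: sqr_ge0.
rewrite (eq_bigl (fun i => (t / 2 < `|b i|) && (`|b i| <= t))); last first.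
  by move=> i; rewrite -ltNge andbC.
apply: ler_sum => i /andP[_ h].
by rewrite -(real_normK (num_real (b i))) lerXn2r ?nnegrE// ltW.
Qed.

Lemma exceedances_double u : 0 < u ->
  (exceedances u)%:R * u ^+ 2 <=
  (exceedances (2 * u))%:R * u ^+ 2 + small_energy (2 * u).
Proof.
move=> u0; rewrite -!sum_pred_const (bigID (fun i => 2 * u < `|b i|))/=.
apply: lerD.
  rewrite le_eqVlt; apply/orP; left; apply/eqP; apply: eq_bigl => i.
  by apply/andP/idP => [[]//|h]; split=> //; apply: lt_trans h; lra.
rewrite /small_energy [leRHS](bigID (fun i => u < `|b i|))/= -[leLHS]addr0.
apply: lerD; last by apply: sumr_ge0 => *; exact: sqr_ge0.
rewrite (eq_bigl (fun i => (`|b i| <= 2 * u) && (u < `|b i|))); last first.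
  by move=> i; rewrite -leNgt andbC.
apply: ler_sum => i /andP[_ h].
by rewrite -(real_normK (num_real (b i))) lerXn2r ?nnegrE ?(ltW u0)// ltW.
Qed.

(** Sum the dyadic shells [t / 2 ^ k.+1 < |b i| <= t / 2 ^ k]: the k-th one has
    energy at most a multiple of [(t / 2 ^ k) ^ (2 - q)], a geometric series. *)
Lemma small_energy_le (A q : R) : 0 <= A -> q < 2 ->
  (forall u, 0 < u -> (exceedances u)%:R <= A * u `^ (- q)) ->
  forall t, 0 < t ->
  small_energy t <= A * 2 `^ q / (1 - 2 `^ (- (2 - q))) * t `^ (2 - q).
Proof.
move=> A0 q2 hA; set B := A * _ / _.
have g1 : 0 < 1 - (2 : R) `^ (- (2 - q)) by rewrite subr_gt0 powR2_lt1// subr_gt0.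
have B0 : 0 <= B by rewrite divr_ge0 ?(ltW g1)// mulr_ge0 ?powR_ge0.
have step t : 0 < t ->
    small_energy t <= small_energy (t / 2) + A * 2 `^ q * t `^ (2 - q).
  move=> t0; apply: le_trans (small_energy_halve t0) _; rewrite lerD2l.
  have h : (exceedances (t / 2))%:R <= A * (t / 2) `^ (- q) by rewrite hA// divr_gt0.
  apply: le_trans (ler_wpM2r (sqr_ge0 t) h) _.
  by rewrite powR_half// opprK powR_2B// le_eqVlt; apply/orP; left; apply/eqP; ring.
have iter k t : 0 < t -> small_energy t <= small_energy (t / 2 ^+ k) + B * t `^ (2 - q).
  elim: k t => [|k IH] t t0.
    by rewrite expr0 divr1 lerDl mulr_ge0 ?powR_ge0.
  have t20 : 0 < t / 2 by rewrite divr_gt0.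
  apply: le_trans (step _ t0) _.
  have := IH _ t20; rewrite -mulrA -invfM -exprS => h.
  apply: le_trans (lerD h (lexx _)) _; rewrite -addrA lerD2l.
  rewrite powR_half// le_eqVlt; apply/orP; left; apply/eqP; rewrite /B.
  by field; rewrite gt_eqF.
(* the part below the smallest shell vanishes as k grows: S is finite *)
move=> t t0; apply/ler_addgt0Pr => eps eps0.
have [k kX] := exp2_unbounded (#|S|%:R * t ^+ 2 / eps + 1).
apply: le_trans (iter k _ t0) _; rewrite addrC lerD2l.
have k1 : 1 <= (2 : R) ^+ k by rewrite exprn_ege1// ler1n.
have tk0 : 0 < t / 2 ^+ k by rewrite divr_gt0// exprn_gt0.
apply: (@le_trans _ _ (#|S|%:R * (t / 2 ^+ k) ^+ 2)).
  apply: (@le_trans _ _ (\sum_(i : S) (t / 2 ^+ k) ^+ 2)); last first.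
    by rewrite sumr_const mulr_natl.
  rewrite [leRHS](bigID (fun i => `|b i| <= t / 2 ^+ k))/= -[leLHS]addr0.
  apply: lerD; last by apply: sumr_ge0 => *; exact: sqr_ge0.
  apply: ler_sum => i h.
  by rewrite -(real_normK (num_real (b i))) lerXn2r ?nnegrE// ltW.
rewrite expr_div_n mulrA ler_pdivrMr ?exprn_gt0//.
have : #|S|%:R * t ^+ 2 / eps < 2 ^+ k by lra.
rewrite ltr_pdivrMr// => h; apply: le_trans (ltW h) _.
rewrite mulrC ler_wpM2l ?(ltW eps0)// -[leLHS]mulr1 expr2 ler_wpM2l//.
Qed.

(** The converse, by summing upwards: the shell [2 ^ k u < |b i| <= 2 ^ k.+1 u]
    has at most a multiple of [(2 ^ k u) ^ (- q)] members. *)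
Lemma exceedances_le (K q : R) : 0 <= K -> 0 < q ->
  (forall w, 0 < w -> small_energy w <= K * w `^ (2 - q)) ->
  forall u, 0 < u ->
  (exceedances u)%:R <= K * 2 `^ (2 - q) / (1 - 2 `^ (- q)) * u `^ (- q).
Proof.
move=> K0 q0 hK; set C := K * _ / _.
have g1 : 0 < 1 - (2 : R) `^ (- q) by rewrite subr_gt0 powR2_lt1.
have C0 : 0 <= C by rewrite divr_ge0 ?(ltW g1)// mulr_ge0 ?powR_ge0.
have step u : 0 < u -> (exceedances u)%:R <=
    (exceedances (2 * u))%:R + K * 2 `^ (2 - q) * u `^ (- q).
  move=> u0; have u20 : 0 < 2 * u by rewrite mulr_gt0.
  rewrite -(ler_pM2r (exprn_gt0 2 u0)).
  apply: le_trans (exceedances_double u0) _; rewrite [leRHS]mulrDl lerD2l.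
  apply: le_trans (hK _ u20) _; rewrite powRM ?(ltW u0)// (powR_2B q u0).
  by rewrite le_eqVlt; apply/orP; left; apply/eqP; ring.
have iter k u : 0 < u -> (exceedances u)%:R <=
    (exceedances (2 ^+ k * u))%:R + C * u `^ (- q).
  elim: k u => [|k IH] u u0.
    by rewrite expr0 mul1r lerDl mulr_ge0 ?powR_ge0.
  have u20 : 0 < 2 * u by rewrite mulr_gt0.
  apply: le_trans (step _ u0) _.
  have := IH _ u20; rewrite mulrA -exprSr => h.
  apply: le_trans (lerD h (lexx _)) _; rewrite -addrA lerD2l.
  rewrite powRM ?(ltW u0)// le_eqVlt; apply/orP; left; apply/eqP; rewrite /C.
  by field; rewrite gt_eqF.
move=> u u0; have [k kX] := exp2_unbounded (\sum_i `|b i| / u).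
apply: le_trans (iter k _ u0) _.
rewrite (_ : exceedances _ = 0%N) ?add0r//.
apply/eqP; rewrite cards_eq0; apply/eqP/setP => i; rewrite !inE.
apply/negbTE; rewrite -leNgt -ler_pdivrMr//; apply: le_trans (ltW kX).
by rewrite (bigD1 i)//= lerDl sumr_ge0// => j _; rewrite divr_ge0// ltW.
Qed.

End finite_families.

(** * Risk of one thresholded coefficient *)

Section coordinate.
Context {R : realType} {d : measure_display} {T : measurableType d}.
Variable P : probability T R.

(** Squared error of the keep-or-kill estimation of [b]; [K] is the event that
    the observation is kept. *)
Definition coord_loss (X : {RV P >-> R}) (K : set T) (b sigma : R) (w : T) : R :=
  ((if w \in K then b + sigma * X w else 0) - b) ^+ 2.

Variables (X : {RV P >-> R}) (K : set T) (b sigma t : R).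
Hypothesis hX : std_normal X.
Hypothesis EX2 : (\int[P]_w (X w ^+ 2)%:E = 1)%E.
Hypothesis mK : measurable K.
Hypotheses (sigma0 : 0 < sigma) (t0 : 0 < t).
Hypothesis Kt : forall w, if w \in K then t ^+ 2 <= (b + sigma * X w) ^+ 2
                          else (b + sigma * X w) ^+ 2 <= t ^+ 2.

Local Notation loss := (coord_loss X K b sigma).

Lemma measurable_coord_loss : measurable_fun setT loss.
Proof.
rewrite /coord_loss; apply: measurable_funX; apply: measurable_funB => //.
apply: measurable_fun_ifT => //.
  apply: (measurable_fun_bool true); rewrite setTI.
  rewrite [X in measurable X](_ : _ = K)//.
  by apply/seteqP; split => w /=; [move/set_mem|move/mem_set].
by apply: measurable_funD => //; exact: measurable_funM.
Qed.

Let mX2 c : measurable_fun setT (fun w => (c * X w ^+ 2)%:E).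
Proof.
by apply/measurable_EFinP; apply: measurable_funM => //; exact: measurable_funX.
Qed.

Let intX2 c : 0 <= c -> (\int[P]_w (c * X w ^+ 2)%:E = c%:E)%E.
Proof.
move=> c0; under eq_integral do rewrite EFinM.
rewrite ge0_integralZl//; first by rewrite EX2 mule1.
- by apply/measurable_EFinP; exact: measurable_funX.
- by move=> w _; rewrite lee_fin sqr_ge0.
Qed.

Let int_cst c : (\int[P]_w c%:E = c%:E)%E.
Proof.
rewrite integral_cst// [X in (_ * X)%E](_ : _ = 1%E) ?mule1//.
exact: probability_setT.
Qed.

(** When the observation is kept the loss is that of the noise; when it is not,
    [|b| <= t + sigma |X|]. *)
Lemma coord_risk_le_threshold :
  (\int[P]_w (loss w)%:E <= (2 * t ^+ 2 + 2 * sigma ^+ 2)%:E)%E.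
Proof.
rewrite EFinD -(int_cst (2 * t ^+ 2)) -(@intX2 (2 * sigma ^+ 2)); last first.
  by rewrite mulr_ge0 ?sqr_ge0.
rewrite -ge0_integralD//; last 2 first.
- by move=> w _; rewrite lee_fin mulr_ge0 ?sqr_ge0.
- by move=> w _; rewrite lee_fin pmulr_rge0 ?sqr_ge0 ?mulr_gt0 ?exprn_gt0.
apply: ge0_le_integral => //.
- by move=> w _; rewrite lee_fin sqr_ge0.
- by apply/measurable_EFinP; exact: measurable_coord_loss.
- by apply: emeasurable_funD => //; exact: mX2.
move=> w _; rewrite -EFinD lee_fin /coord_loss; move: (Kt w); case: ifP => _ h.
  rewrite addrAC subrr add0r exprMn.
  have := mulr_ge0 (sqr_ge0 sigma) (sqr_ge0 (X w)); have := sqr_ge0 t; lra.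
have := sqr_ge0 (b + 2 * (sigma * X w)); rewrite sub0r sqrrN.
move: h; rewrite -mulrA -[sigma ^+ 2 * _]exprMn.
move: (sigma * X w) => z; nra.
Qed.

(** When the observation of a coefficient [|b| <= eps t] is kept, the noise
    exceeds [(1 - eps) t]. *)
Lemma coord_risk_le_small eps c : 0 <= eps <= 1 -> 0 < c < 1 ->
  `|b| <= eps * t ->
  (\int[P]_w (loss w)%:E <= (b ^+ 2 + sigma ^+ 2 *
     (tail_const c * expR (- (c * ((1 - eps) * (t / sigma)) ^+ 2 / 2))))%:E)%E.
Proof.
move=> /andP[e0 e1] c01 be; set a := (1 - eps) * (t / sigma).
have a0 : 0 <= a by rewrite mulr_ge0 ?subr_ge0// divr_ge0// ltW.
have mtail : measurable_fun setT (fun w => (X w ^+ 2 * (a <= `|X w|)%R%:R)%:E).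
  apply/measurable_EFinP; apply: measurable_funM; first exact: measurable_funX.
  apply: (@measurableT_comp _ _ _ _ _ _ (fun b : bool => b%:R : R)) => //.
  by apply: measurable_fun_ler => //; exact: measurableT_comp.
apply: (@le_trans _ _ (\int[P]_w ((b ^+ 2)%:E +
    (sigma ^+ 2)%:E * (X w ^+ 2 * (a <= `|X w|)%R%:R)%:E))%E).
  apply: ge0_le_integral => //.
  - by move=> w _; rewrite lee_fin sqr_ge0.
  - by apply/measurable_EFinP; exact: measurable_coord_loss.
  - by apply: emeasurable_funD => //; exact: emeasurable_funM.
  move=> w _; rewrite -EFinM -EFinD lee_fin /coord_loss; move: (Kt w).
  case: ifP => _ h; last first.
    by rewrite sub0r sqrrN lerDl mulr_ge0 ?sqr_ge0// mulr_ge0 ?sqr_ge0.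
  rewrite addrAC subrr add0r exprMn.
  have -> : a <= `|X w|.
    have ty : t <= `|b + sigma * X w|.
      by rewrite -ler_sqr ?nnegrE ?(ltW t0)// real_normK ?num_real.
    have := ler_normD b (sigma * X w); rewrite normrM (gtr0_norm sigma0) => h2.
    rewrite /a mulrA ler_pdivrMr//; lra.
  by rewrite mulr1 lerDr sqr_ge0.
rewrite ge0_integralD//; last 3 first.
- by move=> w _; rewrite lee_fin sqr_ge0.
- move=> w _; rewrite -EFinM lee_fin pmulr_rge0 ?exprn_gt0//.
  by rewrite mulr_ge0 ?sqr_ge0.
- exact: emeasurable_funM.
rewrite int_cst EFinD leeD2l// ge0_integralZl//; last 2 first.
- by move=> w _; rewrite lee_fin mulr_ge0 ?sqr_ge0.
- by rewrite lee_fin sqr_ge0.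
rewrite [X in (_ <= X)%E]EFinM lee_wpmul2l ?lee_fin ?sqr_ge0//.
exact: std_normal_tail.
Qed.

(** If the sign of the noise is opposite to that of [b] and [|X| < a], then
    [|b + sigma X| < t]: the observation is set to zero and the loss is [b ^ 2]. *)
Lemma coord_risk_ge a : 0 < a -> a * sigma <= t -> `|b| <= t ->
  ((b ^+ 2 * (a * normal_pdf 0 1 a))%:E <= \int[P]_w (loss w)%:E)%E.
Proof.
move=> a0 at_ bt.
have main (I : interval R) : ((a * normal_pdf 0 1 a)%:E <= P (X @^-1` [set` I]))%E ->
    (forall x, x \in I -> `|b + sigma * x| < t) ->
    ((b ^+ 2 * (a * normal_pdf 0 1 a))%:E <= \int[P]_w (loss w)%:E)%E.
  move=> PI It; pose A := X @^-1` [set` I].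
  have mA : measurable A.
    by rewrite -[A]setTI; apply: (measurable_funP X).
  apply: (@le_trans _ _ (\int[P]_(w in A) (b ^+ 2)%:E)%E).
    by rewrite integral_cst// EFinM lee_wpmul2l// lee_fin sqr_ge0.
  apply: (@le_trans _ _ (\int[P]_(w in A) (loss w)%:E)%E); last first.
    apply: ge0_subset_integral => //.
    - by apply/measurable_EFinP; exact: measurable_coord_loss.
    - by move=> w _; rewrite lee_fin sqr_ge0.
  apply: ge0_le_integral => //.
  - by move=> w _; rewrite lee_fin sqr_ge0.
  - by apply/measurable_funTS/measurable_EFinP; exact: measurable_coord_loss.
  move=> w Aw; rewrite lee_fin /coord_loss; move: (Kt w).
  case: ifP => _ h; last by rewrite sub0r sqrrN.
  have := It _ Aw; rewrite ltNge => /negP[].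
  by rewrite -ler_sqr ?nnegrE ?(ltW t0)// real_normK ?num_real.
have [PI1 PI2] := std_normal_small_ball hX a0.
move: bt; rewrite ler_norml => /andP[b1 b2].
have [b0|b0] := leP 0 b.
- apply: main PI2 _ => x; rewrite in_itv/= => /andP[x1 x2].
  have h1 : 0 < (x + a) * sigma by rewrite mulr_gt0//; lra.
  have h2 : 0 < - x * sigma by rewrite mulr_gt0//; lra.
  by rewrite ltr_norml; apply/andP; split; lra.
- apply: main PI1 _ => x; rewrite in_itv/= => /andP[x1 x2].
  have h1 : 0 < (a - x) * sigma by rewrite mulr_gt0//; lra.
  have h2 : 0 < x * sigma by rewrite mulr_gt0.
  by rewrite ltr_norml; apply/andP; split; lra.
Qed.

End coordinate.

(** * Risk of the selected estimator *)

(** Linearity on the span alone suffices, as all partial sums remain in it. *)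
Lemma lin_span_sum (R : realType) (E : set (R -> R)) (L : (R -> R) -> R)
    (K : Type) (e : K -> R -> R) (c : K -> R) (r : seq K) :
  (forall k, E (e k)) ->
  (forall (a : R) u v, lin_span E u -> lin_span E v ->
     L (fun x => a * u x + v x) = a * L u + L v) ->
  L (fun x => \sum_(k <- r) c k * e k x) = \sum_(k <- r) c k * L (e k).
Proof.
move=> eE Llin.
have sp k : lin_span E (e k).
  exists 1%N, (fun=> e k), (fun=> 1); split=> //.
  by apply/funext => x; rewrite big_ord1 mul1r.
have spr q : lin_span E (fun x => \sum_(k <- q) c k * e k x).
  exists (size q), (fun l => e (tnth (in_tuple q) l)), (fun l => c (tnth (in_tuple q) l)).
  by split=> //; apply/funext => x; rewrite [LHS]big_tnth.
elim: r => [|k r IH].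
  have := Llin 0 _ _ (spr [::]) (spr [::]).
  rewrite mul0r add0r big_nil => _; have := Llin 1 _ _ (spr [::]) (spr [::]).
  rewrite mul1r (_ : (fun x => 1 * _ + _) = (fun x => \sum_(k <- [::]) c k * e k x)).
    by move/eqP; rewrite -subr_eq0 opprD addNKr oppr_eq0 => /eqP.
  by apply/funext => x; rewrite !big_nil mulr0 addr0.
rewrite big_cons -IH -(Llin _ _ _ (sp k) (spr r)).
by congr L; apply/funext => x; rewrite big_cons.
Qed.

Section risk.
Context {R : realType} {d : measure_display} {T : measurableType d}.
Variable P : probability T R.
Variables (phi psi : R -> R).
Hypothesis onb : orthonormal_basis `[0, 1] (L2 `[0, 1]) wavelet_index
                   (wavelet_family phi psi).
Variable W : (R -> R) -> {RV P >-> R}.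
Hypothesis hW : white_noise W.
Hypothesis hWlin :
  linear_paths W (lin_span (wavelet_family phi psi @` wavelet_index)).

Let mD : measurable (`[0, 1]%classic : set R). Proof. exact: measurable_itv. Qed.

Local Notation e J := (@wavelets_below R phi psi J).

Lemma std_normal_noise J k : std_normal (W (e J k)).
Proof.
have [gW EW EWW] := hW; have Lk := L2_wavelets_below onb k.
apply: gaussian_std_normal.
- have := gW 1%N (fun=> e J k) (fun=> 1) (fun=> Lk).
  by rewrite (_ : (fun w => _) = W (e J k))//; apply/funext => w; rewrite big_ord1 mul1r.
- exact: EW.
- by rewrite EWW// (wavelets_below_orthonormal onb) eqxx.
Qed.

Lemma integral_noise_sqr J k : (\int[P]_w (W (e J k) w ^+ 2)%:E = 1)%E.
Proof.
have [_ _ EWW] := hW; have Lk := L2_wavelets_below onb k.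
have := EWW _ _ Lk Lk; rewrite (wavelets_below_orthonormal onb) eqxx unlock => <-.
by apply: eq_integral => w _; rewrite expr2.
Qed.

Lemma observation_lincomb J n s w c : L2 `[0, 1] s ->
  observation W n s w (lincomb (e J) c) =
  \sum_k c k * observation W n s w (e J k).
Proof.
move=> Ls; rewrite /observation ip_lincombl//; last exact: L2_wavelets_below.
rewrite (@lin_span_sum _ (wavelet_family phi psi @` wavelet_index) (fun u => W u w)).
- by rewrite mulr_sumr -big_split/=; apply: eq_bigr => k _; ring.
- by move=> k; exists (omap (@detail_index J) k) => //; exact: wavelet_index_detail.
- by move=> a u v uV vV; exact: hWlin.
Qed.

Variables (lambda : nat -> R) (j0 : nat -> int).
Variables (shat : nat -> set (R -> R) -> ((R -> R) -> R) -> R -> R)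
          (mhat : nat -> ((R -> R) -> R) -> set (R -> R)).
Hypothesis hshat : model_selection W (fun n => models phi psi (j0 n)) lambda
       shat mhat.
Variables (n : nat) (s : R -> R).
Hypotheses (n0 : (0 < n)%N) (ln0 : 0 < lambda n) (Ls : L2 `[0, 1] s).

Let J := nlevels (j0 n).

Definition noise_level : R := (Num.sqrt n%:R)^-1.

Definition threshold : R := Num.sqrt (lambda n / n%:R).

Local Notation b := (@coef R phi psi s J).
Local Notation sigma := noise_level.
Local Notation t := threshold.

Let Le : forall k, L2 `[0, 1] (e J k). Proof. exact: L2_wavelets_below. Qed.
Let oe : forall i j, ip `[0, 1] (e J i) (e J j) = (i == j)%:R.
Proof. exact: wavelets_below_orthonormal. Qed.

(** [K i] is the event that the coefficient [i] is kept. The squared error is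
    additive over the coordinates, so the risk sums one-dimensional risks. *)
Lemma risk_eq : exists K : detail J -> set T,
  [/\ forall i, measurable (K i),
      forall i w, if w \in K i
        then t ^+ 2 <= (b i + sigma * W (e J (Some i)) w) ^+ 2
        else (b i + sigma * W (e J (Some i)) w) ^+ 2 <= t ^+ 2 &
      ('E_P[fun w => (norm2 `[0, 1] (selected_estimator shat mhat n
                       (observation W n s w) \- s) ^+ 2)%R] =
       (sigma ^+ 2)%:E
       + \sum_i \int[P]_w (coord_loss (W (e J (Some i))) (K i) (b i) sigma w)%:E
       + (residual phi psi s J)%:E)%E].
Proof.
pose y w := observation W n s w.
have [hs hm mm] := hshat n0 Ls.
have modE := models_submodel phi psi (j0 n); rewrite -/J in modE.
have /choice[A AE] : forall w, exists A, mhat n (y w) = submodel (e J) A.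
  by move=> w; have [+ _] := hm w; rewrite modE => -[A _ <-]; exists A.
have yE w k : y w (e J k) = ip `[0, 1] s (e J k) + sigma * W (e J k) w.
  by rewrite /y /observation ipC.
have sel w : shat n (submodel (e J) (A w)) (y w) = projection (e J) (y w) (A w) /\
    forall i, if i \in A w then lambda n / n%:R <= y w (e J (Some i)) ^+ 2
              else y w (e J (Some i)) ^+ 2 <= lambda n / n%:R.
  apply: (@penalized_minimizer _ _ _ Le
    oe (y w) _ (lambda n / n%:R) (shat n) (A w)).
  - by move=> c; exact: observation_lincomb.
  - by move=> B; apply: hs; rewrite modE; exists B.
  - move=> B; have [_ +] := hm w => /(_ (submodel (e J) B)).
    by rewrite -/(y w) AE; apply; rewrite modE; exists B.
pose K i := [set w | i \in A w].
have mK i : measurable (K i).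
  have -> : K i = \bigcup_(B in [set B : {set detail J} | i \in B])
      [set w | mhat n (y w) = submodel (e J) B].
    apply/seteqP; split=> w /=; first by move=> iA; exists (A w).
    by move=> [B /= iB]; rewrite AE => /(submodel_inj Le oe) eqB; rewrite /K/= eqB.
  apply: fin_bigcup_measurable => [|B _]; first exact: finite_finset.
  by apply: mm; rewrite modE; exists B.
have KA i w : (w \in K i) = (i \in A w).
  by apply/idP/idP => [/set_mem//|h]; exact/mem_set.
have t2 : t ^+ 2 = lambda n / n%:R.
  by rewrite sqr_sqrtr// divr_ge0// ltW.
exists K; split=> //.
  move=> i w; have [_ /(_ i)] := sel w; rewrite KA t2 yE; exact.
have lossE w : norm2 `[0, 1] (selected_estimator shat mhat n (y w) \- s) ^+ 2 =
    sigma ^+ 2 * W (e J None) w ^+ 2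
    + \sum_i coord_loss (W (e J (Some i))) (K i) (b i) sigma w
    + residual phi psi s J.
  rewrite /selected_estimator AE (sel w).1.
  rewrite (norm2_projection_sub Le oe)//.
  congr (_ + _ + _); first by rewrite yE addrAC subrr add0r exprMn.
  by apply: eq_bigr => i _; rewrite /coord_loss KA yE.
rewrite unlock; under eq_integral do rewrite lossE EFinD EFinD -sumEFin.
have mc i : measurable_fun setT (fun w =>
    (coord_loss (W (e J (Some i))) (K i) (b i) sigma w)%:E).
  by apply/measurable_EFinP; apply: measurable_coord_loss.
have mX : measurable_fun setT (fun w => (sigma ^+ 2 * W (e J None) w ^+ 2)%:E).
  by apply/measurable_EFinP; apply: measurable_funM => //; exact: measurable_funX.
have c0 i w : (0 <= (coord_loss (W (e J (Some i))) (K i) (b i) sigma w)%:E)%E.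
  by rewrite lee_fin; exact: sqr_ge0.
have X0 w : (0 <= (sigma ^+ 2 * W (e J None) w ^+ 2)%:E)%E.
  by rewrite lee_fin mulr_ge0 ?sqr_ge0.
have mS : measurable_fun setT (fun w =>
    \sum_i (coord_loss (W (e J (Some i))) (K i) (b i) sigma w)%:E)%E.
  exact: emeasurable_sum.
have S0 w : (0 <=
    \sum_i (coord_loss (W (e J (Some i))) (K i) (b i) sigma w)%:E)%E.
  by apply: sume_ge0 => i _.
rewrite ge0_integralD//=; last 3 first.
- by move=> w _; exact: adde_ge0.
- exact: emeasurable_funD.
- by move=> _ _; rewrite lee_fin; exact: residual_ge0.
rewrite ge0_integralD//= ge0_integral_sum//.
rewrite integral_cst// [X in (_ + _ * X)%E](_ : _ = 1%E) ?mule1; last first.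
  exact: probability_setT.
congr (_ + _ + _)%E; under eq_integral do rewrite EFinM.
rewrite ge0_integralZl//; first by rewrite integral_noise_sqr mule1.
- by apply/measurable_EFinP; exact: measurable_funX.
- by move=> w _; rewrite lee_fin sqr_ge0.
- by rewrite lee_fin sqr_ge0.
Qed.

Let sigma_gt0 : 0 < sigma.
Proof. by rewrite invr_gt0 sqrtr_gt0 ltr0n. Qed.

Let t_gt0 : 0 < t.
Proof. by rewrite sqrtr_gt0 divr_gt0// ltr0n. Qed.

Local Notation risk := ('E_P[fun w => (norm2 `[0, 1]
  (selected_estimator shat mhat n (observation W n s w) \- s) ^+ 2)%R])%E.

Lemma risk_ge a : 0 < a -> a * sigma <= t ->
  ((a * normal_pdf 0 1 a * small_energy b t + residual phi psi s J)%:E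
     <= risk)%E.
Proof.
move=> a0 at_; have [K [mK KP ->]] := risk_eq; rewrite EFinD leeD2r//.
apply: (@le_trans _ _ (\sum_i \int[P]_w
    (coord_loss (W (e J (Some i))) (K i) (b i) sigma w)%:E)%E); last first.
  by rewrite leeDr// lee_fin sqr_ge0.
rewrite /small_energy mulr_sumr -sumEFin big_mkcond/=; apply: lee_sum => i _.
case: ifPn => bi.
  rewrite mulrC; apply: coord_risk_ge (mK i) sigma_gt0 t_gt0 (KP i) _ a0 at_ bi.
  exact: std_normal_noise.
by apply: integral_ge0 => w _; rewrite lee_fin sqr_ge0.
Qed.

Lemma risk_le eps c : 0 <= eps <= 1 -> 0 < c < 1 ->
  (risk <= (sigma ^+ 2
    + (small_energy b (eps * t)
       + #|detail J|%:R * (sigma ^+ 2 * (tail_const c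
           * expR (- (c * ((1 - eps) * (t / sigma)) ^+ 2 / 2))))
       + (exceedances b (eps * t))%:R * (2 * t ^+ 2 + 2 * sigma ^+ 2))
    + residual phi psi s J)%:E)%E.
Proof.
move=> eps01 c01; have [K [mK KP ->]] := risk_eq.
rewrite [X in (_ <= X)%E]EFinD; apply: leeD2r.
rewrite [X in (_ <= X)%E]EFinD; apply: leeD2l.
set M := sigma ^+ 2 * (tail_const c * _); set V := 2 * t ^+ 2 + _.
have M0 : 0 <= M.
  rewrite mulr_ge0 ?sqr_ge0// mulr_ge0 ?expR_ge0// ltW// tail_const_gt0//.
  by case/andP: c01.
have V0 : 0 <= V by rewrite addr_ge0// mulr_ge0// sqr_ge0.
apply: (@le_trans _ _ (\sum_i ((if `|b i| <= eps * t then b i ^+ 2 else 0) + M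
    + (if eps * t < `|b i| then V else 0))%:E)%E).
  apply: lee_sum => i _; have hX := @std_normal_noise J (Some i).
  have hX2 := @integral_noise_sqr J (Some i).
  case: leP => bi.
    rewrite addr0.
    exact: (coord_risk_le_small hX (mK i) sigma_gt0 t_gt0 (KP i) eps01 c01 bi).
  apply: le_trans (coord_risk_le_threshold hX2 (mK i) sigma_gt0 (KP i)) _.
  by rewrite lee_fin add0r lerDr.
rewrite sumEFin lee_fin !big_split/= -!big_mkcond/=.
apply: lerD; last by rewrite sum_pred_const.
by apply: lerD => //; rewrite sumr_const mulr_natl.
Qed.

End risk.

(** * Number of models and resolution levels *)

Lemma sum_powerset (R : comNzRingType) (S : finType) (x : R) :
  \sum_(A : {set S}) x ^+ #|A| = (1 + x) ^+ #|S|.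
Proof.
rewrite addrC; transitivity (\prod_(i : S) (x + 1)); last by rewrite prodr_const.
rewrite bigA_distr; apply: eq_bigr => A _.
by rewrite -big_mkcond/= prodr_const.
Qed.

(** A model with [k] details has dimension [k + 1], so the weighted sum is a
    binomial expansion. *)
Lemma sum_models (R : realType) (phi psi : R -> R) (J : int) (v : R) :
  orthonormal_basis `[0, 1] (L2 `[0, 1]) wavelet_index
    (wavelet_family phi psi) ->
  \sum_(m \in models phi psi J)
     expR (- (v * (dimension `[0, 1] m)%:R / 2)) =
  expR (- (v / 2)) * (1 + expR (- (v / 2))) ^+ (2 ^ nlevels J).-1.
Proof.
move=> onb; rewrite models_submodel fsbig_image; last first.
  move=> A B _ _; apply: submodel_inj.
    exact: L2_wavelets_below.
  exact: wavelets_below_orthonormal.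
rewrite (fsbigE (index_enum _))//=; last 2 first.
- exact: index_enum_uniq.
- by move=> A _; rewrite mem_index_enum.
rewrite (eq_bigl xpredT) => [|A]; last by apply/mem_set.
rewrite -card_detail -sum_powerset mulr_sumr; apply: eq_bigr => A _.
rewrite (dimension_submodel (L2_wavelets_below onb (J := _))
  (wavelets_below_orthonormal onb (J := _))).
by rewrite -exprS -expRM_natl; congr expR; rewrite -mulr_natl; ring.
Qed.

Section numerics.
Context {R : realType}.
Implicit Types (x z L eta : R).

Lemma expR_half_le x : 0 <= x <= 1 -> expR (x / 2) <= 1 + x.
Proof.
move=> /andP[x0 x1]; rewrite -[x / 2]opprK expRN invf_ple ?posrE ?expR_gt0//; last lra.
apply: le_trans (expR_ge1Dx _); by rewrite -[leLHS]mul1r ler_pdivrMr; nra.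
Qed.

Lemma expR_half_exp_le N x : 0 <= x <= 1 -> expR (x / 2) ^+ N <= (1 + x) ^+ N.
Proof.
move=> x01; apply: lerXn2r (expR_half_le x01); rewrite nnegrE ?expR_ge0//.
by rewrite addr_ge0//; case/andP: x01.
Qed.

(** Taking logarithms in [x (1 + x) ^ N <= 1], with [x = exp (- L)] and
    [x / 2 <= ln (1 + x)], gives [N x <= 2 L]; and [L <= exp (eta L) / eta]. *)
Lemma powerset_sum_bound L eta (N : nat) : 0 <= L -> 0 < eta ->
  expR (- L) * (1 + expR (- L)) ^+ N <= 1 ->
  N%:R * expR (- ((1 + eta) * L)) <= 2 / eta.
Proof.
move=> L0 eta0; set x := expR (- L) => h.
have x01 : 0 <= x <= 1 by rewrite expR_ge0/= expR_le1 oppr_le0.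
have Nx : N%:R * x / 2 <= L.
  rewrite -ler_expR.
  have -> : N%:R * x / 2 = N%:R * (x / 2) by rewrite mulrA.
  rewrite expRM_natl; apply: le_trans (expR_half_exp_le N x01) _.
  by rewrite -[expR L]mul1r -ler_pdivrMr ?expR_gt0// -expRN mulrC.
have -> : N%:R * expR (- ((1 + eta) * L)) = N%:R * x * expR (- (eta * L)).
  by rewrite /x -mulrA -expRD; congr (_ * expR _); ring.
apply: (@le_trans _ _ (2 * L * expR (- (eta * L)))).
  by rewrite ler_wpM2r ?expR_ge0//; lra.
rewrite expRN ler_pdivrMr ?expR_gt0// mulrAC ler_pdivlMr//.
have := expR_ge1Dx (eta * L); nra.
Qed.

End numerics.

Section resolution.
Context {R : realType}.
Variables (lambda : nat -> R) (j0 : nat -> int).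
Hypothesis lambda_pos : forall n, (0 < n)%N -> 0 < lambda n.
Hypothesis lambda_mono : forall n n', (0 < n)%N -> (n <= n')%N ->
  lambda n <= lambda n'.
Hypothesis lambda_lim : (fun n => n%:R^-1 * lambda n) @ \oo --> (0 : R).
Hypothesis j0P : forall n, (0 < n)%N ->
  (2 : R) ^ (j0 n) <= n%:R * (lambda n)^-1 < (2 : R) ^ (j0 n + 1).

Local Notation theta n := (lambda n / n%:R).

Lemma theta_gt0 n : (0 < n)%N -> 0 < theta n.
Proof. by move=> n0; rewrite divr_gt0 ?lambda_pos ?ltr0n. Qed.

Lemma theta_eventually e : 0 < e ->
  exists N, (0 < N)%N /\ forall n, (N <= n)%N -> theta n < e.
Proof.
move=> e0; have /cvgrPdist_lt/(_ e e0)[N _ hN] := lambda_lim.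
exists N.+1; split=> // n Nn; have := hN n (ltnW Nn) => /=.
rewrite sub0r normrN mulrC ger0_norm// ltW// theta_gt0//.
exact: leq_ltn_trans Nn.
Qed.

Lemma theta_bounded : exists2 B, 1 <= B & forall n, (0 < n)%N -> theta n <= B.
Proof.
have [N [N0 hN]] := theta_eventually ltr01.
exists (1 + lambda N); first by rewrite lerDl ltW// lambda_pos.
move=> n n0; have [Nn|nN] := leqP N n.
  by rewrite (le_trans (ltW (hN _ Nn)))// lerDl ltW// lambda_pos.
apply: (@le_trans _ _ (lambda N)); last by rewrite lerDr.
apply: le_trans (lambda_mono n0 (ltnW nN)).
by rewrite ler_pdivrMr ?ltr0n// ler_peMr ?ler1n// ltW// lambda_pos.
Qed.

(** Since [lambda] is non-decreasing, [theta] decreases at most as fast as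
    [n ^ -1]. *)
Lemma theta_slow n : (0 < n)%N -> theta n <= 2 * theta n.+1.
Proof.
move=> n0; apply: (@le_trans _ _ (lambda n.+1 / n%:R)).
  by rewrite ler_wpM2r ?invr_ge0 ?ler0n ?lambda_mono.
rewrite mulrCA ler_wpM2l ?(ltW (lambda_pos _))// ler_pdivlMr ?ltr0n//.
rewrite mulrC ler_pdivrMr ?ltr0n// -natrM ler_nat.
by rewrite mul2n -addnn -addn1 leq_add2l.
Qed.

(** It also holds when [j0 n] is negative: then there is no detail, and
    [theta n > 1]. *)
Lemma inv_level_lt_theta n : (0 < n)%N -> (2 ^+ nlevels (j0 n))^-1 < 2 * theta n.
Proof.
move=> n0; have /andP[_] := j0P n0; have th0 := theta_gt0 n0.
rewrite -[n%:R / lambda n]invf_div => h.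
have : (theta n)^-1 < 2 * 2 ^+ nlevels (j0 n).
  apply: lt_le_trans h _; case: (j0 n) => [J|J] /=.
    by rewrite exprzDr ?unitfE// expr1z mulrC.
  rewrite expr0 mulr1 NegzE (@le_trans _ _ (2 ^ 0))//; last by rewrite expr0z ler1n.
  by rewrite ler_eXz2l ?ltr1n// -addn1 PoszD opprD addrNK oppr_le0.
have a0 : 0 < (2 : R) ^+ nlevels (j0 n) by rewrite exprn_gt0.
move: a0; move: (2 ^+ _) => a a0.
rewrite -[X in X < _]mul1r ltr_pdivrMr// => h1.
by rewrite -[X in X < _]mul1r ltr_pdivrMr//; lra.
Qed.

Lemma theta_le_inv_level n (J : nat) : (0 < n)%N -> j0 n = J -> theta n <= (2 ^+ J)^-1.
Proof.
move=> n0 jJ; have /andP[+ _] := j0P n0; rewrite jJ -[n%:R / lambda n]invf_div.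
rewrite -exprnP => h; rewrite -[leLHS]invrK.
by rewrite lef_pV2 ?posrE ?exprn_gt0 ?invr_gt0 ?theta_gt0.
Qed.

Lemma j0_step n : (0 < n)%N -> j0 n.+1 <= j0 n + 1.
Proof.
move=> n0; have /andP[h1 _] := j0P (ltn0Sn n); have /andP[_ h2] := j0P n0.
rewrite -ltzD1 -(@ltr_eXz2l R 2) ?ltr1n//.
apply: le_lt_trans h1 _; rewrite exprzDr ?unitfE// expr1z.
apply: (@le_lt_trans _ _ (n%:R * (lambda n)^-1 * 2)); last by rewrite ltr_pM2r.
rewrite mulrAC ler_pM ?invr_ge0 ?(ltW (lambda_pos _))//.
  by rewrite -natrM ler_nat muln2 -addnn -addn1 leq_add2l.
by rewrite lef_pV2 ?posrE ?lambda_pos ?lambda_mono.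
Qed.

Lemma j0_unbounded (J : int) : exists2 n, (0 < n)%N & J < j0 n.
Proof.
have e0 : 0 < (2 : R) ^ (- (J + 1)) by rewrite exprz_gt0.
have [N [N0 /(_ N (leqnn N)) hN]] := theta_eventually e0.
exists N => //; have /andP[_ h2] := j0P N0.
rewrite -(ltrD2r 1) -(@ltr_eXz2l R 2) ?ltr1n//; apply: lt_trans h2.
rewrite -[X in X < _]invrK invr_expz -[N%:R / lambda N]invf_div.
by rewrite ltf_pV2 ?posrE ?theta_gt0.
Qed.

(** A discrete intermediate value argument: unbounded, with steps at most 1. *)
Lemma j0_hits (J : int) : j0 1%N <= J -> exists2 n, (0 < n)%N & j0 n = J.
Proof.
move=> J1; have [m m0 Jm] := j0_unbounded J.
have ex : exists n, (0 < n)%N && (J < j0 n) by exists m; rewrite m0.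
case: (ex_minnP ex) => -[//|n] /andP[_ Jn] nmin.
have [n0|n0] := posnP n; first by move: Jn; rewrite n0 ltNge J1.
exists n => //; apply/eqP; rewrite eq_le; apply/andP; split.
  rewrite leNgt; apply/negP => h; have := nmin n; rewrite n0 h => /(_ isT).
  by rewrite ltnn.
by have := lt_le_trans Jn (j0_step n0); rewrite ltzD1.
Qed.

Section initial_level.
Variable kappa : R.
Hypothesis kappa1 : 1 < kappa.
Hypothesis j0_mono : forall n n', (0 < n)%N -> (n <= n')%N -> j0 n <= j0 n'.
Let L n := (Num.sqrt (kappa^-1 * lambda n) - 1) ^+ 2 / 2.
Hypothesis powerset_sum : forall n, (0 < n)%N ->
  expR (- L n) * (1 + expR (- L n)) ^+ (2 ^ nlevels (j0 n)).-1 < 1.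

(** Suppose [j0 1 >= 1]; then every collection contains details. Let
    [z n = sqrt (lambda n / kappa)], so that [x = exp (- (z n - 1) ^ 2 / 2)]. The
    condition [x (1 + x) < 1] keeps [z n] away from 1: either [z n < 1 / 5] or
    [z n > 9 / 5]. In the first case [x >= 1 / 2], so [x (1 + x) ^ 2 > 1] and
    there is only one detail: [j0 n = 1]. This is the case of [n = 1], as
    [lambda 1 <= 1 / 2]. The second case holds for large [n], as [j0] is
    unbounded. But at the first jump from one case to the other, [n / lambda n]
    is below 4 just before and at least 2 just after, so [lambda] is multiplied
    by at most 4, whereas [z n ^ 2] is multiplied by more than 81. *)
Lemma j0_1_le0 : j0 1%N <= 0.
Proof.
rewrite leNgt; apply/negP => j1.
pose z n := Num.sqrt (kappa^-1 * lambda n).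
have kappa0 : 0 < kappa by apply: lt_trans kappa1.
have z0 n : 0 <= z n by exact: sqrtr_ge0.
have z2 n : (0 < n)%N -> lambda n = kappa * z n ^+ 2.
  move=> n0; rewrite sqr_sqrtr ?mulr_ge0 ?invr_ge0 ?(ltW kappa0) ?(ltW (lambda_pos _))//.
  by rewrite mulVKf// gt_eqF.
have jn n : (0 < n)%N -> exists2 J, j0 n = Posz J & (0 < J)%N.
  move=> n0; have := lt_le_trans j1 (j0_mono (ltn0Sn 0) n0).
  by case: (j0 n) => // J; exists J.
have xL n : 1 - L n <= expR (- L n) by exact: expR_ge1Dx.
have pw n k : (0 < n)%N -> (k <= (2 ^ nlevels (j0 n)).-1)%N ->
    expR (- L n) * (1 + expR (- L n)) ^+ k < 1.
  move=> n0 kN; apply: le_lt_trans (powerset_sum n0).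
  by rewrite ler_wpM2l ?expR_ge0// ler_weXn2l// lerDl expR_ge0.
have dich n : (0 < n)%N -> z n < 1 / 5 \/ 9 / 5 < z n.
  move=> n0; have [|z1] := ltP (z n) (1 / 5); first by left.
  have [|z9] := ltP (9 / 5) (z n); first by right.
  have [J jJ J0] := jn n n0.
  have := pw n 1%N n0; rewrite jJ expr1.
  have -> : (1 <= (2 ^ nlevels J).-1)%N.
    by rewrite ltn_predRL (@ltn_exp2l 2 0).
  move=> /(_ isT); have := xL n; rewrite /L -/(z n) => x1.
  have : (z n - 1) ^+ 2 <= 16 / 25 by nra.
  by move: x1; move: (expR _) => x; nra.
have small n : (0 < n)%N -> z n < 1 / 5 -> j0 n = 1.
  move=> n0 z1; have [J jJ J0] := jn n n0; rewrite jJ; congr Posz.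
  apply/eqP; rewrite eqn_leq J0 andbT leqNgt; apply/negP => J2.
  have := pw n 2%N n0; rewrite jJ.
  have -> : (2 <= (2 ^ nlevels J).-1)%N.
    by rewrite ltn_predRL; apply: (@leq_trans (2 ^ 2)) => //; rewrite leq_exp2l.
  move=> /(_ isT); have := xL n; rewrite /L -/(z n) => x1.
  have : (z n - 1) ^+ 2 <= 1 by have := z0 n; nra.
  by move: x1; move: (expR _) => x x1 h; rewrite expr2; nra.
have z1 : z 1%N < 1 / 5.
  case: (dich 1%N (ltn0Sn 0)) => // z9; have /andP[+ _] := j0P (ltn0Sn 0).
  have [J -> J0] := jn 1%N (ltn0Sn 0); rewrite mul1r -exprnP => h.
  have h2 : (2 : R) <= (lambda 1%N)^-1.
    by rewrite div1r in h; apply: le_trans h; rewrite -[leLHS]expr1 ler_weXn2l// ler1n.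
  have l1 := lambda_pos (ltn0Sn 0); have := z2 1%N (ltn0Sn 0).
  have : 2 * lambda 1%N <= 1 by rewrite -ler_pdivlMr// mul1r.
  have zz : 81 / 25 < z 1%N ^+ 2 by nra.
  have : 0 <= (kappa - 1) * z 1%N ^+ 2 by rewrite mulr_ge0 ?sqr_ge0// subr_ge0 ltW.
  by lra.
have [m m0 jm] := j0_unbounded 1.
have ex : exists n, (0 < n)%N && (9 / 5 < z n).
  exists m; rewrite m0/=; case: (dich m m0) => // /(small m m0) jm1.
  by move: jm; rewrite jm1.
case: (ex_minnP ex) => -[//|n] /andP[_ zn1] nmin.
have n0 : (0 < n)%N.
  by case: n zn1 {nmin} => // zn1; have := lt_trans zn1 z1; lra.
have zn : z n < 1 / 5.
  case: (dich n n0) => // zn; have := nmin n; rewrite n0 zn => /(_ isT).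
  by rewrite ltnn.
have /andP[_] := j0P n0; have /andP[+ _] := j0P (ltn0Sn n).
rewrite (small n n0 zn); have [J -> J0] := jn n.+1 (ltn0Sn n).
rewrite -!exprnP => h1 h2.
have {}h1 : 2 * lambda n.+1 <= n.+1%:R.
  rewrite -ler_pdivlMr ?lambda_pos//; apply: le_trans h1.
  by rewrite -[leLHS]expr1 ler_weXn2l// ler1n.
have {}h2 : n%:R < 4 * lambda n.
  rewrite -ltr_pdivrMr ?lambda_pos//; apply: lt_le_trans h2 _.
  by rewrite expr2; lra.
have h3 : n.+1%:R <= 2 * n%:R :> R.
  by rewrite -natrM ler_nat mul2n -addnn -addn1 leq_add2l.
move: h1 h2; rewrite (z2 n n0) (z2 n.+1 (ltn0Sn n)) => h1 h2.
have : z n ^+ 2 < 1 / 25 by have := z0 n; nra.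
have : 81 / 25 < z n.+1 ^+ 2 by nra.
by nra.
Qed.

End initial_level.
End resolution.

(** * Besov and weak balls *)

Lemma card_eq_finset (S : finType) (A : {set S}) : ([set` A] #= `I_#|A|)%card.
Proof.
have -> : [set` A] = @enum_val S (mem A) @` setT.
  apply/seteqP; split=> x /=; last by move=> [i _ <-]; exact: enum_valP.
  by move=> xA; exists (enum_rank_in xA x) => //; rewrite enum_rankK_in.
apply: card_eq_trans (inj_card_eq _) _; first by move=> i j _ _; exact: enum_val_inj.
by rewrite card_eq_sym; exact: card_II.
Qed.

Section weak_balls.
Context {R : realType}.
Variables (phi psi : R -> R).
Hypothesis onb : orthonormal_basis `[0, 1] (L2 `[0, 1]) wavelet_index
                   (wavelet_family phi psi).
Variable s : R -> R.
Hypothesis Ls : L2 `[0, 1] s.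

Local Notation b J := (@coef R phi psi s J).

Definition large_indices (u : R) : set (nat * nat) :=
  [set jk | (jk.2 < 2 ^ jk.1)%N /\ u < `|beta psi s jk.1 jk.2|].

Lemma coefE J (i : detail J) :
  coef phi psi s i = beta psi s (detail_index i).1 (detail_index i).2.
Proof. by []. Qed.

(** Holds for any [u]; for [u < 0] it shows that the set of large indices is
    infinite. *)
Lemma exceedances_card J u N :
  (large_indices u #= `I_N)%card -> (exceedances (b J) u <= N)%N.
Proof.
move=> uN; rewrite -card_le_II.
pose B := [set i : detail J | u < `|b J i|]%SET.
have Bi : (@detail_index J @` [set` B] #= `I_#|B|)%card.
  apply: card_eq_trans (inj_card_eq _) (card_eq_finset B).
  by move=> i j _ _; exact: detail_index_inj.
rewrite -(card_le_eql Bi) -(card_le_eqr uN); apply: subset_card_le => jk /=.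
move=> [i]; rewrite /= inE => ui <-; split=> //=; exact: ltn_ord.
Qed.

Lemma coef_sqr_le J (i : detail J) : coef phi psi s i ^+ 2 <= ip `[0, 1] s s.
Proof.
have := residual_ge0 onb Ls J; rewrite /residual subr_ge0; apply: le_trans.
by rewrite (bigD1 (Some i))//= lerDl sumr_ge0// => *; exact: sqr_ge0.
Qed.

Lemma beta_sqr_le j k : (k < 2 ^ j)%N -> beta psi s j k ^+ 2 <= ip `[0, 1] s s.
Proof.
move=> kj; have [i ie] := detail_indexP (jk := (j, k)) (ltnSn j) kj.
by have := coef_sqr_le i; rewrite coefE ie.
Qed.

(** If [m] coefficients exceed [u] then the m-th largest is at least [u]. *)
Lemma weak_ball_exceedances q rad J u : 0 < q -> 0 < rad ->
  weak_ball psi q rad s -> 0 < u ->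
  (exceedances (b J) u)%:R <= rad `^ q * u `^ (- q).
Proof.
move=> q0 rad0 [_ hs] u0; set m := exceedances _ _.
have [m0|m0] := posnP m.
  by rewrite m0 mulr_ge0 ?powR_ge0.
have um : u <= rearrangement psi s m.
  apply: lb_le_inf.
    exists (Num.sqrt (ip `[0, 1] s s)); exists 0%N => //.
    rewrite [X in (X #= _)%card](_ : _ = set0).
      by rewrite II0; exact: card_eq00.
    apply/seteqP; split=> // -[j k] /= [kj]; apply/negP; rewrite -leNgt.
    rewrite -sqrtr_sqr ler_sqrt ?beta_sqr_le//.
    exact: le_trans (sqr_ge0 _) (beta_sqr_le kj).
  move=> v [N Nm vN]; rewrite leNgt; apply/negP => vu.
  have := exceedances_card J vN; apply/negP; rewrite -ltnNge.
  apply: leq_trans Nm _; apply: subset_leq_card; apply/fintype.subsetP => i.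
  by rewrite !inE; exact: lt_trans.
have : m%:R `^ q^-1 * u <= rad.
  apply: (@le_trans _ _ (m%:R `^ q^-1 * rearrangement psi s m)).
    by rewrite ler_wpM2l ?powR_ge0.
  rewrite -lee_fin; apply: le_trans hs; apply: ereal_sup_ubound.
  by exists m.
have q00 : 0 <= q by exact: ltW.
move=> /(ge0_ler_powR q00) -/(_ _ _)/wrap[].
all: rewrite ?nnegrE ?mulr_ge0 ?powR_ge0 ?(ltW u0) ?(ltW rad0)//.
rewrite powRM ?powR_ge0 ?(ltW u0)// -powRrM mulVf ?gt_eqF// powRr1//.
by rewrite powRN ler_pdivlMr ?powR_gt0.
Qed.

(** Any [u] slightly above [(A / n) ^ (1 / q)] is exceeded by fewer than [n]
    coefficients. They are counted at a finite level, beyond which all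
    coefficients are smaller than [u]. *)
Lemma exceedances_weak_ball q A : 0 < q -> 0 <= A ->
  (forall J u, 0 < u -> (exceedances (b J) u)%:R <= A * u `^ (- q)) ->
  weak_ball psi q (A `^ q^-1) s.
Proof.
move=> q0 A0 hA; split=> //; apply: ge_ereal_sup => _ [n /= n0 <-]; rewrite lee_fin.
have n0' : 0 < n%:R :> R by rewrite ltr0n.
suff : rearrangement psi s n <= (A / n%:R) `^ q^-1.
  move=> h; apply: le_trans (ler_wpM2l (powR_ge0 _ _) h) _.
  by rewrite -powRM ?divr_ge0 ?(ltW n0')// mulrCA divff ?gt_eqF// mulr1.
(* negative values are exceeded infinitely often, so the infimum is proper *)
have nonneg v : (exists2 N, (N < n)%N & (large_indices v #= `I_N)%card) -> 0 <= v.
  move=> [N _ vN]; rewrite leNgt; apply/negP => v0.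
  have := exceedances_card N.+1 vN; rewrite /exceedances.
  rewrite (_ : [set _ | _]%SET = [set: detail N.+1]%SET); last first.
    by apply/setP => i; rewrite !inE (lt_le_trans v0).
  rewrite cardsT card_detail; apply/negP; rewrite -ltnNge.
  by rewrite ltn_predRL; exact: ltn_expl.
apply/ler_addgt0Pr => eps eps0; set v := (A / n%:R) `^ q^-1.
have v0 : 0 <= v by exact: powR_ge0.
have u0 : 0 < v + eps by rewrite ltr_wpDl.
apply: ge_inf; first by exists 0 => w; exact: nonneg.
have [J resJ] : exists J, residual phi psi s J < (v + eps) ^+ 2.
  have /cvgrPdist_lt/(_ _ (exprn_gt0 2 u0))[J _ hJ] := residual_cvg0 onb Ls.
  exists J; have := hJ J (leqnn J) => /=.
  by rewrite sub0r normrN ger0_norm// residual_ge0.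
have Jlarge j k : (k < 2 ^ j)%N -> v + eps < `|beta psi s j k| -> (j < J)%N.
  move=> kj; apply: contraTT; rewrite -leqNgt -leNgt => Jj.
  rewrite -ler_sqr ?nnegrE ?(ltW u0)// real_normK ?num_real// ltW//.
  apply: le_lt_trans resJ; have := residual_ge0 onb Ls j.+1.
  rewrite !residualE (@big_cat_nat _ _ _ J 0 j.+1)//=; last exact: leqW.
  rewrite big_nat_recr//=.
  have : 0 <= \sum_(J <= i < j) level_energy psi s i.
    by apply: sumr_ge0 => *; exact: level_energy_ge0.
  have : beta psi s j k ^+ 2 <= level_energy psi s j.
    rewrite /level_energy (bigD1 (Ordinal kj))//= lerDl sumr_ge0// => *.
    exact: sqr_ge0.
  lra.
exists (exceedances (b J) (v + eps)).
  rewrite -(ltr_nat R); apply: le_lt_trans (hA _ _ u0) _.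
  rewrite powRN ltr_pdivrMr ?powR_gt0// mulrC -ltr_pdivrMr//.
  have vq : v `^ q = A / n%:R.
    by rewrite /v -powRrM mulVf ?gt_eqF// powRr1// divr_ge0// ltW.
  by rewrite -vq gt0_ltr_powR ?nnegrE ?(ltW u0)// ltrDl.
pose B := [set i : detail J | v + eps < `|b J i|]%SET.
rewrite [X in (X #= _)%card](_ : _ = @detail_index J @` [set` B]).
  apply: card_eq_trans (inj_card_eq _) (card_eq_finset B).
  by move=> i j _ _; exact: detail_index_inj.
apply/seteqP; split=> jk /=.
  move=> [kj ujk]; have [i ie] := detail_indexP (Jlarge _ _ kj ujk) kj.
  by exists i => //=; rewrite inE coefE ie.
move=> [i]; rewrite /= inE => ui <-; split=> //=; exact: ltn_ord.
Qed.

Lemma besov_ballP a rad : besov_ball psi a rad s <->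
  forall J : nat, 2 `^ (2 * J%:R * a) * residual phi psi s J <= rad.
Proof.
split=> [[_ h] J|h].
  rewrite -lee_fin EFinM -(tail_series onb Ls); apply: le_trans h.
  by apply: ereal_sup_ubound; exists J.
split=> //; apply: ge_ereal_sup => _ [J _ <-].
by rewrite (tail_series onb Ls) -EFinM lee_fin.
Qed.

End weak_balls.

(** * The maxiset *)

Section maxiset.
Context {R : realType} {d : measure_display} {T : measurableType d}.
Variable P : probability T R.
Variables (phi psi : R -> R).
Hypothesis onb : orthonormal_basis `[0, 1] (L2 `[0, 1]) wavelet_index
                   (wavelet_family phi psi).
Variable W : (R -> R) -> {RV P >-> R}.
Hypothesis hW : white_noise W.
Hypothesis hWlin :
  linear_paths W (lin_span (wavelet_family phi psi @` wavelet_index)).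
Variables (alpha : R) (lambda : nat -> R) (j0 : nat -> int).
Hypothesis alpha0 : 0 < alpha.
Hypothesis lambda_pos : forall n, (0 < n)%N -> 0 < lambda n.
Hypothesis lambda_mono : forall n n', (0 < n)%N -> (n <= n')%N ->
  lambda n <= lambda n'.
Hypothesis lambda_lim : (fun n => n%:R^-1 * lambda n) @ \oo --> (0 : R).
Hypothesis j0P : forall n, (0 < n)%N ->
  (2 : R) ^ (j0 n) <= n%:R * (lambda n)^-1 < (2 : R) ^ (j0 n + 1).
Hypothesis j0_1_le0 : j0 1%N <= 0.
Variables (shat : nat -> set (R -> R) -> ((R -> R) -> R) -> R -> R)
          (mhat : nat -> ((R -> R) -> R) -> set (R -> R)).
Hypothesis hshat : model_selection W (fun n => models phi psi (j0 n)) lambda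
       shat mhat.

Local Notation a := (alpha / (1 + 2 * alpha)).
Local Notation q := (2 / (1 + 2 * alpha)).
Local Notation theta n := (lambda n / n%:R).
Local Notation level n := (nlevels (j0 n)).
Local Notation t n := (threshold lambda n).
Local Notation b s J := (@coef R phi psi s J).
Local Notation risk n s := ('E_P[fun w => (norm2 `[0, 1]
  (selected_estimator shat mhat n (observation W n s w) \- s) ^+ 2)%R])%E.

Let d0 : 0 < 1 + 2 * alpha. Proof. by rewrite addr_gt0// mulr_gt0. Qed.
Let a0 : 0 < a. Proof. by rewrite divr_gt0. Qed.
Let q0 : 0 < q. Proof. by rewrite divr_gt0. Qed.
Let q_a : 2 - q = 4 * a. Proof. by field; rewrite gt_eqF. Qed.
Let a1 : 2 * a < 1.
Proof. by rewrite mulrA ltr_pdivrMr// mul1r ltrDr. Qed.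
Let q2 : q < 2. Proof. by move: q_a a0; move: q a => u v; lra. Qed.

Let rate_sqr n : rate lambda alpha n ^+ 2 = theta n `^ (2 * a).
Proof.
by rewrite /rate -powR_mulrn ?powR_ge0// -powRrM [2 * a]mulrC.
Qed.

Let threshold_sqr n : (0 < n)%N -> t n ^+ 2 = theta n.
Proof. by move=> n0; rewrite sqr_sqrtr// ltW// theta_gt0. Qed.

Let threshold_gt0 n : (0 < n)%N -> 0 < t n.
Proof. by move=> n0; rewrite sqrtr_gt0 theta_gt0. Qed.

Let sqr_pow u : 0 <= u -> (u ^+ 2) `^ (2 * a) = u `^ (2 - q).
Proof.
by move=> u0; rewrite -powR_mulrn// -powRrM q_a; congr (_ `^ _); ring.
Qed.

Lemma maxiset_ballP rad s :
  maxiset_ball W (selected_estimator shat mhat) (rate lambda alpha) rad s <->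
  L2 `[0, 1] s /\ forall n, (0 < n)%N ->
    (risk n s <= (rad ^+ 2 * theta n `^ (2 * a))%:E)%E.
Proof.
have equiv n : (0 < n)%N ->
    ((rate lambda alpha n ^- 2)%:E * risk n s <= (rad ^+ 2)%:E)%E =
    (risk n s <= (rad ^+ 2 * theta n `^ (2 * a))%:E)%E.
  move=> n0; rewrite rate_sqr lee_pdivrMl ?powR_gt0 ?theta_gt0//.
  by rewrite -EFinM mulrC.
split=> -[Ls h]; split=> //.
  move=> n n0; rewrite -equiv//; apply: le_trans h.
  by apply: ereal_sup_ubound; exists n.
by apply: ge_ereal_sup => _ [n n0 <-]; rewrite equiv// h.
Qed.

(* c0 bounds below the probability that a coefficient of modulus at most the
   threshold is set to zero, for all n at once: lambda 1 is the least lambda n *)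
Let c1 := Num.sqrt (lambda 1%N).
Let c0 := c1 * normal_pdf 0 1 c1.

Let c1_gt0 : 0 < c1. Proof. by rewrite sqrtr_gt0 lambda_pos. Qed.
Let c0_gt0 : 0 < c0.
Proof.
rewrite mulr_gt0// normal_pdfE ?oner_neq0// mulr_gt0 ?expR_gt0//.
by rewrite normal_peak_gt0// oner_neq0.
Qed.

Let m_gt0 : 0 < Num.min c0 1. Proof. by rewrite lt_min c0_gt0 ltr01. Qed.

Let Kc rad := rad ^+ 2 * 2 `^ (2 * a) / Num.min c0 1.

Section lower.
Variables (s : R -> R) (Ls : L2 `[0, 1] s).

(** The levels of [J] that are missing in [J'] are part of the residual at [J']. *)
Lemma small_energy_residual J J' u :
  small_energy (b s J) u <= small_energy (b s J') u + residual phi psi s J'.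
Proof.
pose se j := \sum_(k < 2 ^ j)
  (if `|beta psi s j k| <= u then beta psi s j k ^+ 2 else 0).
have seE L : small_energy (b s L) u = \sum_(0 <= j < L) se j.
  rewrite /small_energy big_mkcond/= big_mkord.
  exact: (@sum_detail R L (fun jk => if `|beta psi s jk.1 jk.2| <= u
    then beta psi s jk.1 jk.2 ^+ 2 else 0)).
have se0 j : 0 <= se j.
  by apply: sumr_ge0 => k _; case: ifP => // _; exact: sqr_ge0.
rewrite !seE; have [JJ|JJ] := leqP J J'.
  rewrite [in leRHS](@big_cat_nat _ _ _ J)//= -addrA lerDl addr_ge0 ?sumr_ge0//.
  exact: residual_ge0.
rewrite (@big_cat_nat _ _ _ J')//=; last exact: ltnW.
rewrite lerD2l; apply: (@le_trans _ _ (\sum_(J' <= j < J) level_energy psi s j)).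
  apply: ler_sum => j _; apply: ler_sum => k _; case: ifP => // _; exact: sqr_ge0.
have := residual_ge0 onb Ls J; rewrite !residualE.
by rewrite [in X in 0 <= X](@big_cat_nat _ _ _ J')//=; [lra|exact: ltnW].
Qed.

Variable rad : R.
Hypothesis s_rad :
  maxiset_ball W (selected_estimator shat mhat) (rate lambda alpha) rad s.

Let s_risk n : (0 < n)%N -> (risk n s <= (rad ^+ 2 * theta n `^ (2 * a))%:E)%E.
Proof. by have /maxiset_ballP[_] := s_rad; exact. Qed.

Let risk_bound n : (0 < n)%N ->
  c0 * small_energy (b s (level n)) (t n) + residual phi psi s (level n)
    <= rad ^+ 2 * theta n `^ (2 * a).
Proof.
move=> n0; rewrite -lee_fin; apply: le_trans (s_risk n0).
apply: (risk_ge onb hW hWlin hshat n0 (lambda_pos n0) Ls c1_gt0).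
rewrite /c1 /noise_level /threshold -sqrtrV ?ler0n// -sqrtrM; last first.
  exact/ltW/lambda_pos.
by rewrite ler_wsqrtr// ler_wpM2r ?invr_ge0 ?ler0n// lambda_mono.
Qed.

Let se_ge0 n : (0 < n)%N -> 0 <= c0 * small_energy (b s (level n)) (t n).
Proof. by move=> _; rewrite mulr_ge0 ?small_energy_ge0// ltW. Qed.

Lemma maxiset_besov_ball : besov_ball psi a (rad ^+ 2) s.
Proof.
apply/(besov_ballP onb Ls) => J.
have J1 : j0 1%N <= Posz J by apply: le_trans j0_1_le0 _.
have [n n0 jn] := j0_hits lambda_pos lambda_mono lambda_lim j0P J1.
have := risk_bound n0; have := se_ge0 n0; rewrite jn /= => h1 h2.
have h3 : residual phi psi s J <= rad ^+ 2 * theta n `^ (2 * a) by lra.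
have h4 : theta n `^ (2 * a) <= (2 `^ (2 * J%:R * a))^-1.
  rewrite powR_exp2V.
  have th0 := theta_gt0 lambda_pos n0.
  have le2 := theta_le_inv_level lambda_pos j0P n0 jn.
  have a20 : 0 <= 2 * a by rewrite mulr_ge0 ?(ltW a0).
  by rewrite (ge0_ler_powR a20) ?nnegrE ?invr_ge0 ?exprn_ge0 ?(ltW th0).
rewrite mulrC -ler_pdivlMr ?powR_gt0//; apply: le_trans h3 _.
by rewrite ler_wpM2l ?sqr_ge0.
Qed.

Let small_energy_bound J u : 0 < u ->
  small_energy (b s J) u <= Kc rad * u `^ (2 - q).
Proof.
move=> u0.
(* n is the last index before the threshold first falls below u; if it is at
   most u from the start, take n = 1, for which there are no details *)
suff [n [n0 hu hn]] : exists n, [/\ (0 < n)%N, theta n <= 2 * u ^+ 2 &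
    small_energy (b s (level n)) u <= small_energy (b s (level n)) (t n)].
  apply: le_trans (small_energy_residual J (level n) u) _.
  have se0 := small_energy_ge0 (b s (level n)) (t n).
  have r0 := residual_ge0 onb Ls (level n).
  have rb := risk_bound n0.
  have : Num.min c0 1 * (small_energy (b s (level n)) u + residual phi psi s (level n))
      <= rad ^+ 2 * theta n `^ (2 * a).
    apply: le_trans rb; rewrite mulrDr lerD//.
      apply: (@le_trans _ _ (Num.min c0 1 * small_energy (b s (level n)) (t n))).
        by rewrite ler_wpM2l ?(ltW m_gt0).
      by rewrite ler_wpM2r// ge_min lexx.
    by rewrite -[leRHS]mul1r ler_wpM2r// ge_min lexx orbT.
  rewrite mulrC -ler_pdivlMr// => h; apply: le_trans h _.
  rewrite /Kc [leRHS]mulrAC ler_wpM2r ?invr_ge0 ?(ltW m_gt0)//.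
  rewrite -[leRHS]mulrA ler_wpM2l ?sqr_ge0//.
  rewrite -sqr_pow ?(ltW u0)// -powRM ?sqr_ge0//.
  have a20 : 0 <= 2 * a by rewrite mulr_ge0 ?(ltW a0).
  have u20 : 0 <= 2 * u ^+ 2 by rewrite mulr_ge0 ?sqr_ge0.
  by rewrite (ge0_ler_powR a20) ?nnegrE ?(ltW (theta_gt0 lambda_pos n0)).
have [le1|gt1] := leP (theta 1%N) (u ^+ 2).
  exists 1%N; split=> //; first by have := sqr_ge0 u; lra.
  have -> : level 1%N = 0%N.
    by move: j0_1_le0; case: (j0 1%N) => // -[].
  have E0 v : small_energy (b s 0) v = 0 by rewrite /small_energy big1// => -[[]].
  by rewrite !E0.
have u20 : 0 < u ^+ 2 by rewrite exprn_gt0.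
have [N [N0 hN]] := theta_eventually lambda_pos lambda_lim u20.
have ex : exists n, (0 < n)%N && (theta n < u ^+ 2).
  by exists N; rewrite N0 hN.
case: (ex_minnP ex) => -[//|n] /andP[_ hn] nmin.
have n0 : (0 < n)%N.
  by case: n hn {nmin} => // hn; have := lt_trans hn gt1; rewrite ltxx.
have un : u ^+ 2 <= theta n.
  rewrite leNgt; apply/negP => h; have := nmin n; rewrite n0 h => /(_ isT).
  by rewrite ltnn.
exists n; split=> //.
  apply: le_trans (theta_slow lambda_pos lambda_mono n0) _.
  by rewrite ler_wpM2l// ltW.
have ut : u <= t n.
  by rewrite -ler_sqr ?nnegrE ?(ltW u0) ?sqrtr_ge0// threshold_sqr.
rewrite /small_energy [leRHS](bigID (fun i => `|b s (level n) i| <= u))/= -[leLHS]addr0.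
apply: lerD; last by apply: sumr_ge0 => *; exact: sqr_ge0.
rewrite le_eqVlt; apply/orP; left; apply/eqP; apply: eq_bigl => i.
by apply/idP/andP => [h|[]//]; split=> //; exact: le_trans ut.
Qed.

Lemma maxiset_weak_ball :
  weak_ball psi q ((Kc rad * 2 `^ (2 - q) / (1 - 2 `^ (- q))) `^ q^-1) s.
Proof.
have Kc0 : 0 <= Kc rad.
  by rewrite divr_ge0 ?(ltW m_gt0)// mulr_ge0 ?sqr_ge0 ?powR_ge0.
apply: (exceedances_weak_ball onb Ls q0).
  apply: divr_ge0; first by rewrite mulr_ge0 ?powR_ge0.
  by rewrite subr_ge0 ltW// powR2_lt1.
move=> J u u0; apply: exceedances_le => // w w0; exact: small_energy_bound.
Qed.

End lower.

Lemma maxiset_sub_ball rad : exists2 rad', 0 < rad' &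
  maxiset_ball W (selected_estimator shat mhat) (rate lambda alpha) rad
  `<=` besov_ball psi a rad' `&` weak_ball psi q rad'.
Proof.
exists (rad ^+ 2
  + (Kc rad * 2 `^ (2 - q) / (1 - 2 `^ (- q))) `^ q^-1 + 1).
  by rewrite ltr_wpDl// addr_ge0 ?sqr_ge0 ?powR_ge0.
move=> s hs; have [Ls _] := hs; split.
  have [_ h] := maxiset_besov_ball Ls hs; split=> //; apply: le_trans h _.
  by rewrite lee_fin -addrA lerDl addr_ge0 ?powR_ge0.
have [_ h] := maxiset_weak_ball Ls hs; split=> //; apply: le_trans h _.
by rewrite lee_fin [leRHS]addrAC lerDr addr_ge0 ?sqr_ge0.
Qed.

Section upper.
Variable rad : R.
Hypothesis rad0 : 0 < rad.

(* 1 - eps is the fraction of the threshold that the noise has to exceed, and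
   c < 1 pays for the factor X ^ 2 in the Gaussian tail *)
Variables (eps c C : R).
Hypotheses (eps01 : 0 < eps <= 1) (c01 : 0 < c < 1).
Hypothesis tails : forall n, (0 < n)%N ->
  #|detail (level n)|%:R * expR (- (c * (1 - eps) ^+ 2 * lambda n / 2)) <= C.

(** The four constants bound the four parts of the risk: [H] the father wavelet,
    [C1] and [C2] the bias and the noise of the small coefficients, [C3] the large
    coefficients and [C4] the levels that are not estimated. *)
Lemma ball_sub_maxiset : exists2 rad', 0 < rad' &
  besov_ball psi a rad `&` weak_ball psi q rad `<=`
  maxiset_ball W (selected_estimator shat mhat) (rate lambda alpha) rad'.
Proof.
have [B B1 thB] := theta_bounded lambda_pos lambda_mono lambda_lim.
have l1 : 0 < lambda 1%N by exact: lambda_pos.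
have eps0 : 0 < eps by case/andP: eps01.
have a20 : 0 <= 2 * a by rewrite mulr_ge0 ?(ltW a0).
pose A := rad `^ q.
have A0 : 0 <= A by exact: powR_ge0.
pose H := B `^ (1 - 2 * a) / lambda 1%N.
pose C1 := A * 2 `^ q / (1 - 2 `^ (- (2 - q))) * eps `^ (2 - q).
pose C2 := C * tail_const c * H.
pose C3 := A * eps `^ (- q) * (2 + 2 / lambda 1%N).
pose C4 := rad * 2 `^ (2 * a).
pose Ct := H + (C1 + C2 + C3) + C4.
exists (`|Ct| + 1); first by rewrite ltr_wpDl.
move=> s [hbes hweak]; have Ls : L2 `[0, 1] s by case: hbes.
apply/maxiset_ballP; split=> // n n0.
have th0 := theta_gt0 lambda_pos n0; have t0 := threshold_gt0 n0.
have ln0 := lambda_pos n0; have nR0 : 0 < n%:R :> R by rewrite ltr0n.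
set J := level n; set th := theta n `^ (2 * a).
have th_ge0 : 0 <= th by exact: powR_ge0.
have s2 : noise_level n ^+ 2 = n%:R^-1 :> R.
  by rewrite /noise_level exprVn sqr_sqrtr// ltW.
have sth : n%:R^-1 <= theta n / lambda 1%N.
  rewrite mulrAC ler_peMl ?invr_ge0 ?ler0n// ler_pdivlMr// mul1r.
  exact: lambda_mono.
have thH : theta n / lambda 1%N <= H * th.
  rewrite /H [leRHS]mulrAC ler_wpM2r ?invr_ge0 ?(ltW l1)//.
  have -> : theta n = theta n `^ (1 - 2 * a) * th.
    rewrite /th -powRD ?subrK ?powRr1 ?(ltW th0)//.
    by apply/implyP => _; rewrite gt_eqF.
  rewrite ler_wpM2r// ge0_ler_powR ?nnegrE ?subr_ge0 ?(ltW a1) ?(ltW th0) ?thB//.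
  by rewrite (le_trans _ B1).
have s2H : noise_level n ^+ 2 <= H * th by rewrite s2 (le_trans sth).
have count u : 0 < u -> (exceedances (b s J) u)%:R <= A * u `^ (- q).
  by move=> u0; exact: (weak_ball_exceedances onb Ls).
have et0 : 0 < eps * t n by rewrite mulr_gt0.
have tq : t n `^ (2 - q) = th by rewrite -sqr_pow ?(ltW t0)// threshold_sqr.
have b1 : small_energy (b s J) (eps * t n) <= C1 * th.
  apply: le_trans (small_energy_le A0 q2 count et0) _.
  by rewrite powRM ?(ltW eps0) ?(ltW t0)// tq /C1 mulrA.
have b2 : #|detail J|%:R * (noise_level n ^+ 2 * (tail_const c
     * expR (- (c * ((1 - eps) * (t n / noise_level n)) ^+ 2 / 2)))) <= C2 * th.
  have tn : (t n / noise_level n) ^+ 2 = lambda n.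
    by rewrite expr_div_n s2 threshold_sqr// invrK divfK// gt_eqF.
  have Tc : 0 < tail_const c by apply: tail_const_gt0; case/andP: c01.
  have -> : c * ((1 - eps) * (t n / noise_level n)) ^+ 2 / 2 =
      c * (1 - eps) ^+ 2 * lambda n / 2 by rewrite exprMn tn mulrA.
  have := tails n0; rewrite -/J; move: (expR _) => E hE.
  have C0 : 0 <= C by apply: le_trans (tails n0); rewrite mulr_ge0 ?expR_ge0.
  have -> : #|detail J|%:R * (noise_level n ^+ 2 * (tail_const c * E)) =
      #|detail J|%:R * E * (tail_const c * noise_level n ^+ 2) by ring.
  have -> : C2 * th = C * (tail_const c * (H * th)) by rewrite /C2; ring.
  apply: (@le_trans _ _ (C * (tail_const c * noise_level n ^+ 2))).
    by rewrite ler_wpM2r// mulr_ge0 ?sqr_ge0// ltW.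
  by rewrite ler_wpM2l// ler_wpM2l// ltW.
have b3 : (exceedances (b s J) (eps * t n))%:R
    * (2 * t n ^+ 2 + 2 * noise_level n ^+ 2) <= C3 * th.
  have h1 := count _ et0.
  have h2 : 2 * t n ^+ 2 + 2 * noise_level n ^+ 2 <= (2 + 2 / lambda 1%N) * t n ^+ 2.
    rewrite s2 threshold_sqr// [leRHS]mulrDl lerD2l -mulrA ler_wpM2l// mulrC.
    exact: sth.
  apply: le_trans (ler_pM _ _ h1 h2) _ => //.
    by rewrite addr_ge0// mulr_ge0// sqr_ge0.
  rewrite powRM ?(ltW eps0) ?(ltW t0)// -tq powR_2B// /C3 le_eqVlt.
  by apply/orP; left; apply/eqP; ring.
have b4 : residual phi psi s J <= C4 * th.
  have := (besov_ballP onb Ls a rad).1 hbes J; rewrite -ler_pdivlMl ?powR_gt0//.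
  move=> h; apply: le_trans h _; rewrite mulrC /C4 -[leRHS]mulrA ler_wpM2l ?(ltW rad0)//.
  rewrite powR_exp2V.
  rewrite /th -powRM ?(ltW th0)//.
  apply: ge0_ler_powR => //; rewrite ?nnegrE ?invr_ge0 ?exprn_ge0//.
    by rewrite mulr_ge0// ltW.
  exact/ltW/(inv_level_lt_theta lambda_pos j0P n0).
have eps01' : 0 <= eps <= 1 by case/andP: eps01 => e0 ->; rewrite ltW.
apply: le_trans (risk_le onb hW hWlin hshat n0 ln0 Ls eps01' c01) _.
rewrite lee_fin -/J.
apply: (@le_trans _ _ (Ct * th)).
  have -> : Ct * th = H * th + (C1 * th + C2 * th + C3 * th) + C4 * th.
    by rewrite /Ct; ring.
  by rewrite !lerD.
rewrite ler_wpM2r// (le_trans (ler_norm _))//.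
have := normr_ge0 Ct; nra.
Qed.

End upper.
End maxiset.

Theorem proposition4 (R : realType)
    (d : measure_display) (T : measurableType d) (P : probability T R)
    (r : nat) (hr : (1 <= r)%N)
    (phi psi : R -> R) (hwav : wavelet_setting r phi psi)
    (W : (R -> R) -> {RV P >-> R}) (hW : white_noise W)
    (hWlin : linear_paths W (lin_span (wavelet_family phi psi @` wavelet_index)))
    (alpha0 alpha : R) (halpha0 : 0 < alpha0) (halpha0r : alpha0 < r%:R)
    (halpha : 0 < alpha) (halphale : alpha <= alpha0)
    (lambda : nat -> R)
    (hlambda_pos : forall n, (0 < n)%N -> 0 < lambda n)
    (hlambda_mono : forall n n', (0 < n)%N -> (n <= n')%N ->
       lambda n <= lambda n')
    (hlambda_lim : (fun n => n%:R^-1 * lambda n) @ \oo --> (0 : R))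
    (j0 : nat -> int)
    (hj0 : forall n, (0 < n)%N ->
       (2 : R) ^ (j0 n) <= n%:R * (lambda n)^-1 < (2 : R) ^ (j0 n + 1))
    (hj0_mono : forall n n', (0 < n)%N -> (n <= n')%N -> j0 n <= j0 n')
    (shat : nat -> set (R -> R) -> ((R -> R) -> R) -> R -> R)
    (mhat : nat -> ((R -> R) -> R) -> set (R -> R))
    (hshat : model_selection W (fun n => models phi psi (j0 n)) lambda
       shat mhat)
    (n0 : nat) (delta p kappa : R) (hn0 : (0 < n0)%N)
    (hdelta : 0 < delta <= 1 / 2) (hp : 0 < p < 1) (hkappa : 1 < kappa)
    (hdoubling : forall n, (n0 <= n)%N ->
       lambda (2 * n)%N <= 2 * (1 - delta) * lambda n)
    (hUpsilon : Upsilon delta p alpha0 <= lambda n0)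
    (hsum : forall n, (0 < n)%N ->
       \sum_(m \in models phi psi (j0 n))
          expR (- ((Num.sqrt (kappa^-1 * lambda n) - 1) ^+ 2
                   * (dimension `[0, 1] m)%:R / 2))
       <= Num.sqrt (1 - p)) :
  ball_equiv
    (maxiset_ball W (selected_estimator shat mhat) (rate lambda alpha))
    (fun rad => besov_ball psi (alpha / (1 + 2 * alpha)) rad
                `&` weak_ball psi (2 / (1 + 2 * alpha)) rad).
Proof.
case: hwav => _ _ _ onb.
pose L n := (Num.sqrt (kappa^-1 * lambda n) - 1) ^+ 2 / 2.
have L0 n : 0 <= L n by rewrite divr_ge0 ?sqr_ge0.
have kappa0 : 0 < kappa by apply: lt_trans hkappa.
have sum_lt1 n : (0 < n)%N ->
    expR (- L n) * (1 + expR (- L n)) ^+ (2 ^ nlevels (j0 n)).-1 < 1.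
  move=> n_gt0; have := hsum n n_gt0; rewrite sum_models// => h.
  apply: le_lt_trans h _; rewrite -[ltRHS]sqrtr1 ltr_sqrt//; case/andP: hp; lra.
have j1 := j0_1_le0 hlambda_pos hlambda_lim hj0 hkappa hj0_mono sum_lt1.
split=> rad rad0; first exact: (maxiset_sub_ball onb hW hWlin halpha
  hlambda_pos hlambda_mono hlambda_lim hj0 j1 hshat).
(* xi serves both as c and as 1 - eps, so that the tail has the exponent
   xi ^ 3 lambda / 2; Bernoulli's inequality gives xi ^ 3 > 1 / kappa *)
pose xi := 1 - (1 - kappa^-1) / 4.
have k1 : kappa^-1 < 1 by rewrite invf_lt1.
have k0 : 0 < kappa^-1 by rewrite invr_gt0.
have xi01 : 3 / 4 < xi < 1 by rewrite /xi; apply/andP; split; lra.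
have xi3 : kappa^-1 < xi ^+ 3.
  have -> : kappa^-1 = 4 * xi - 3 by rewrite /xi; lra.
  case/andP: xi01 => h1 h2; rewrite !exprS expr0 mulr1.
  have : 0 < (1 - xi) * (1 - xi) by rewrite mulr_gt0// subr_gt0.
  by nra.
pose eta := xi ^+ 3 * kappa - 1.
have eta0 : 0 < eta by rewrite subr_gt0 -ltr_pdivrMr// div1r.
apply: (ball_sub_maxiset onb hW hWlin halpha hlambda_pos hlambda_mono
  hlambda_lim hj0 hshat rad0 (eps := 1 - xi) (c := xi)
  (C := expR ((1 + eta) / 2) * (2 / eta))).
- by case/andP: xi01 => h1 h2; apply/andP; split; lra.
- by case/andP: xi01 => h1 h2; apply/andP; split; lra.
move=> n n_gt0; rewrite card_detail.
have := powerset_sum_bound (L0 n) eta0 (ltW (sum_lt1 n n_gt0)) => h.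
apply: (@le_trans _ _ ((2 ^ nlevels (j0 n)).-1%:R
    * (expR ((1 + eta) / 2) * expR (- ((1 + eta) * L n)))))%R; last first.
  by rewrite mulrCA ler_wpM2l ?expR_ge0.
rewrite ler_wpM2l// -expRD ler_expR.
set z := Num.sqrt (kappa^-1 * lambda n).
have z0 : 0 <= z by exact: sqrtr_ge0.
have ln_ : lambda n = kappa * z ^+ 2.
  rewrite sqr_sqrtr ?mulr_ge0 ?invr_ge0 ?(ltW kappa0) ?(ltW (hlambda_pos _ _))//.
  by rewrite mulVKf// gt_eqF.
have -> : xi * (1 - (1 - xi)) ^+ 2 * lambda n / 2 = (1 + eta) * (z ^+ 2 / 2).
  by rewrite ln_ /eta; field.
(* dropping the term z from (z - 1) ^ 2 / 2 costs the factor exp ((1 + eta) / 2) *)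
have zL : z ^+ 2 / 2 + 1 / 2 = L n + z by rewrite /L -/z; field.
have : 0 <= (1 + eta) * z by rewrite mulr_ge0// addr_ge0// ltW.
move: zL; move: (L n) (z ^+ 2 / 2) => u v zL hz.
have -> : v = u + z - 1 / 2 by lra.
by lra.
Qed.
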